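(* Let $\mathsf C$ be a braided monoidal category in which coequalizers exist and are preserved by the monoidal product (with any object), and in which the composite of regular epimorphisms is a regular epimorphism. Let $(t_1,t_2,t_3,t_4,e_1,e_2,j)$ be a regular weak multiplier bimonoid in $\mathsf C$ with underlying object $A$, with multiplication $m=(j1).t_1$ and base object $p\colon A\to L$. Assume that $m$ is a regular epimorphism and is non-degenerate with respect to some class $\mathcal Y$ of objects containing $I$, $A$, $A^2$ and $L$. Assume further that the morphism $n_1\colon LA\to A$ is non-degenerate on the right with respect to $\mathcal Y$. Then the following hold. (1) There is an associative multiplication $\mu\colon L^2\to L$ with respect to which $n_1$ is an associative action, i.e. $n_1.(\mu 1)=n_1.(1n_1)$. (2) There is a coassociative comultiplication $\delta\colon L\to L^2$ such that $\delta.p.m=(pp).t_1$. (3) $\mu.\delta=1$. (4) $\delta$ is a morphism of $L$-bimodules, that is, $(\mu 1).(1\delta)=\delta.\mu=(1\mu).(\delta 1)$ as morphisms $L^2\to L^2$. (5) $\delta$ admits a counit $\varepsilon\colon L\to I$ satisfying $\varepsilon.p=j$. In particular, $L$ carries the structure of a coseparable comonoid.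
   Context: Notation. Composition is written $g.f$ (first $f$, then $g$); identity morphisms are written $1$; the monoidal product is juxtaposition (of objects and of morphisms), $A^n$ is the $n$-fold monoidal power, $I$ is the monoidal unit, $c$ is the braiding; associativity and unit isomorphisms are suppressed. Reversed/inverse categories. $\mathsf C^{\mathsf{rev}}$ is $\mathsf C$ with the reversed monoidal product $X\otimes^{\mathsf{rev}}Y=YX$ and the same braiding; identities stated in $\mathsf C^{\mathsf{rev}}$ arise from those in $\mathsf C$ by reversing the order of every monoidal product ($t1\leftrightarrow 1t$, $1c\leftrightarrow c1$, $j1\leftrightarrow 1j$, etc.). $\overline{\mathsf C}$ is the same monoidal category with the inverse braiding (interchange $c$ and $c^{-1}$). $\overline{\mathsf C}^{\mathsf{rev}}$ has both changes. Non-degeneracy. A morphism $v\colon ZV\to W$ is non-degenerate on the left with respect to a class $\mathcal Y$ of objects if for any object $X$ and any $Y\in\mathcal Y$ the map $\mathsf C(X,VY)\to\mathsf C(ZX,WY)$, $g\mapsto (v1).(1g)$ is injective. It is non-degenerate on the right with respect to $\mathcal Y$ if $v.c\colon VZ\to W$ is non-degenerate on the left with respect to $\mathcal Y$. A multiplication $m\colon A^2\to A$ is non-degenerate with respect to $\mathcal Y$ if it is so both on the left and on the right. Weakly counital fusion morphism. In a braided monoidal category this is an object $A$ with morphisms $t,e\colon A^2\to A^2$ and $j\colon A\to I$ such that, with $m:=(j1).t$: (I) $(t1).(c^{-1}1).(1t).(c1).(1t)=(1t).(t1)$; (II) $e.e=e$; (III) $e.t=t$; (IV) $(m1).(1c).(t1).(1c^{-1}).(1e)=(m1).(1c).(t1).(1c^{-1})$;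 (V) $(e1).(1t)=(1t).(e1)$; (VI) $(t1).(1c).(e1).(1c^{-1})=(1e).(t1)$; (VII) $m.(1j1).(t1)=m.(11j).(1e).(1c)$; (VIII) $(j1).(m1).(1c).(t1)=m.(1j1).(1e).(1c)$. Such an $m$ is automatically associative. Regular weak multiplier bimonoid. It consists of an object $A$ and morphisms $t_1,t_2,t_3,t_4,e_1,e_2\colon A^2\to A^2$, $j\colon A\to I$ such that, with $m:=(j1).t_1$: (a) $m$ is non-degenerate with respect to some class containing $I,A,A^2$; (b) $(m1).(1t_1)=(1m).(t_21)$; $(1m).(1c^{-1}).(t_11)=(1m).(t_31).(1c^{-1})$; $(m1).(c^{-1}1).(1t_1)=(1m).(t_41)$; $(1m).(1c^{-1}).(t_21)=(m1).(1t_3)$; $(m1).(c^{-1}1).(1t_2)=(m1).(1t_4).(c^{-1}1)$; $(m1).(c^{-1}1).(1t_3)=(1m).(1c^{-1}).(t_41)$; (c) $(t_k1).(1t_l)=(1t_l).(t_k1)$ for $k\in\{2,4\}$, $l\in\{1,3\}$; (d) $m=(j1).t_1=(1j).t_2=(j1).t_3.c=(1j).t_4.c$; (e) $(mm).(1c1).(11e_1)=(mm).(1c1).(e_211)$ as morphisms $A^4\to A^2$; (f) $(t_1,e_1,j)$, $(t_2,e_2,j)$, $(t_3,e_2,j)$, $(t_4,e_1,j)$ are weakly counital fusion morphisms in $\mathsf C$, $\mathsf C^{\mathsf{rev}}$, $\overline{\mathsf C}$, $\overline{\mathsf C}^{\mathsf{rev}}$, respectively (these four requirements are equivalent given the others).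 Base object. $p\colon A\to L$ is the coequalizer of $(j1).e_1$ and $(1j).e_1\colon A^2\to A$; $L$ is called the base object. There are unique morphisms $n_1\colon LA\to A$ and $n_2\colon AL\to A$ with $n_1.(p1)=(j1).e_1$ and $n_2.(1p)=(j1).t_4.c$. Coseparable comonoid: a comonoid $(L,\delta,\varepsilon)$ for which there is $\mu\colon L^2\to L$ with $\mu.\delta=1$ and $(\mu1).(1\delta)=\delta.\mu=(1\mu).(\delta1)$. *)

(* Defs.v *)
From Stdlib Require Import List.
Import ListNotations.

Set Implicit Arguments.
Unset Strict Implicit.
Unset Printing Implicit Defensive.

Declare Scope cat_scope.
Delimit Scope cat_scope with cat.
Local Open Scope cat_scope.

Record category := Category {
  Ob :> Type;
  Hom : Ob -> Ob -> Type;
  idm : forall X, Hom X X;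
  comp : forall X Y Z, Hom Y Z -> Hom X Y -> Hom X Z;
  comp1m : forall X Y (f : Hom X Y), comp (idm Y) f = f;
  compm1 : forall X Y (f : Hom X Y), comp f (idm X) = f;
  compA : forall W X Y Z (h : Hom Y Z) (g : Hom X Y) (f : Hom W X),
    comp h (comp g f) = comp (comp h g) f }.

Arguments Hom {c} X Y.
Arguments idm {c} X.
Arguments comp {c X Y Z} g f.
Notation "g ∘ f" := (comp g f) (at level 40, left associativity) : cat_scope.

Section Coequalizers.

Variable C : category.

Definition is_coequalizer (X Y Q : C) (f g : Hom X Y) (q : Hom Y Q) : Prop :=
  q ∘ f = q ∘ g /\
  forall (Z : C) (h : Hom Y Z), h ∘ f = h ∘ g -> exists! k : Hom Q Z, k ∘ q = h.

Definition regular_epi (Y Q : C) (q : Hom Y Q) : Prop :=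
  exists (X : C) (f g : Hom X Y), is_coequalizer f g q.

Definition has_coequalizers : Prop :=
  forall (X Y : C) (f g : Hom X Y),
  exists (Q : C) (q : Hom Y Q), is_coequalizer f g q.

Definition regular_epis_compose : Prop :=
  forall (X Y Z : C) (f : Hom X Y) (g : Hom Y Z),
    regular_epi f -> regular_epi g -> regular_epi (g ∘ f).

End Coequalizers.

Record monoidal_category := MonoidalCategory {
  mon_cat :> category;
  tens : mon_cat -> mon_cat -> mon_cat;
  tensm : forall X X' Y Y' : mon_cat,
    Hom X X' -> Hom Y Y' -> Hom (tens X Y) (tens X' Y');
  unit_ob : mon_cat;
  assoc : forall X Y Z, Hom (tens (tens X Y) Z) (tens X (tens Y Z));
  assocV : forall X Y Z, Hom (tens X (tens Y Z)) (tens (tens X Y) Z);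
  lunit : forall X, Hom (tens unit_ob X) X;
  lunitV : forall X, Hom X (tens unit_ob X);
  runit : forall X, Hom (tens X unit_ob) X;
  runitV : forall X, Hom X (tens X unit_ob);
  tensm1 : forall X Y, tensm (idm X) (idm Y) = idm (tens X Y);
  tensm_comp : forall (X X' X'' Y Y' Y'' : mon_cat)
    (f' : Hom X' X'') (f : Hom X X') (g' : Hom Y' Y'') (g : Hom Y Y'),
    tensm (f' ∘ f) (g' ∘ g) = tensm f' g' ∘ tensm f g;
  assoc_nat : forall (X X' Y Y' Z Z' : mon_cat)
    (f : Hom X X') (g : Hom Y Y') (h : Hom Z Z'),
    assoc X' Y' Z' ∘ tensm (tensm f g) h = tensm f (tensm g h) ∘ assoc X Y Z;
  lunit_nat : forall (X Y : mon_cat) (f : Hom X Y),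
    lunit Y ∘ tensm (idm unit_ob) f = f ∘ lunit X;
  runit_nat : forall (X Y : mon_cat) (f : Hom X Y),
    runit Y ∘ tensm f (idm unit_ob) = f ∘ runit X;
  assocK : forall X Y Z, assocV X Y Z ∘ assoc X Y Z = idm _;
  assocVK : forall X Y Z, assoc X Y Z ∘ assocV X Y Z = idm _;
  lunitK : forall X, lunitV X ∘ lunit X = idm _;
  lunitVK : forall X, lunit X ∘ lunitV X = idm _;
  runitK : forall X, runitV X ∘ runit X = idm _;
  runitVK : forall X, runit X ∘ runitV X = idm _;
  pentagon : forall W X Y Z,
    tensm (idm W) (assoc X Y Z) ∘ assoc W (tens X Y) Z ∘ tensm (assoc W X Y) (idm Z)
    = assoc W X (tens Y Z) ∘ assoc (tens W X) Y Z;
  triangle : forall X Y,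
    tensm (idm X) (lunit Y) ∘ assoc X unit_ob Y = tensm (runit X) (idm Y) }.

Arguments tens {m} X Y.
Arguments tensm {m X X' Y Y'} f g.
Arguments unit_ob {m}.
Arguments assoc {m} X Y Z.
Arguments assocV {m} X Y Z.
Arguments lunit {m} X.
Arguments lunitV {m} X.
Arguments runit {m} X.
Arguments runitV {m} X.
Notation "X ⊗ Y" := (tens X Y) (at level 36, right associativity) : cat_scope.
Notation "f ⊗m g" := (tensm f g) (at level 36, right associativity) : cat_scope.

Definition coequalizers_preserved (C : monoidal_category) : Prop :=
  forall (X Y Q : C) (f g : Hom X Y) (q : Hom Y Q), is_coequalizer f g q ->
  forall Z : C,
    is_coequalizer (idm Z ⊗m f) (idm Z ⊗m g) (idm Z ⊗m q) /\
    is_coequalizer (f ⊗m idm Z) (g ⊗m idm Z) (q ⊗m idm Z).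

Record braided_monoidal_category := BraidedMonoidalCategory {
  br_mon :> monoidal_category;
  braid : forall X Y : br_mon, Hom (X ⊗ Y) (Y ⊗ X);
  braidV : forall X Y : br_mon, Hom (Y ⊗ X) (X ⊗ Y);
  braid_nat : forall (X X' Y Y' : br_mon) (f : Hom X X') (g : Hom Y Y'),
    braid X' Y' ∘ (f ⊗m g) = (g ⊗m f) ∘ braid X Y;
  braidK : forall X Y, braidV X Y ∘ braid X Y = idm _;
  braidVK : forall X Y, braid X Y ∘ braidV X Y = idm _;
  hexagon1 : forall X Y Z,
    assoc Y Z X ∘ braid X (Y ⊗ Z) ∘ assoc X Y Z
    = (idm Y ⊗m braid X Z) ∘ assoc Y X Z ∘ (braid X Y ⊗m idm Z);
  hexagon2 : forall X Y Z,
    assocV Z X Y ∘ braid (X ⊗ Y) Z ∘ assocV X Y Z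
    = (braid X Z ⊗m idm Y) ∘ assocV X Z Y ∘ (idm X ⊗m braid Y Z) }.

Arguments braid {b} X Y.
Arguments braidV {b} X Y.

Lemma inv_unique (C : category) (X Y : C) (f f' : Hom X Y) (g g' : Hom Y X) :
  g ∘ f = idm X -> f' ∘ g' = idm Y -> f = f' -> g = g'.
Proof.
intros gf f'g' ff'. rewrite <- (compm1 g), <- f'g', <- ff', compA, gf.
apply comp1m.
Qed.

Lemma cancel_comp (C : category) (X Y Z : C)
    (f : Hom X Y) (f' : Hom Y X) (g : Hom Y Z) (g' : Hom Z Y) :
  f' ∘ f = idm X -> g' ∘ g = idm Y -> (f' ∘ g') ∘ (g ∘ f) = idm X.
Proof.
intros Hf Hg. rewrite compA, <- (compA f' g' g), Hg, compm1. exact Hf.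
Qed.

Lemma cancel_comp3 (C : category) (W X Y Z : C) (f : Hom W X) (f' : Hom X W)
    (g : Hom X Y) (g' : Hom Y X) (h : Hom Y Z) (h' : Hom Z Y) :
  f' ∘ f = idm W -> g' ∘ g = idm X -> h' ∘ h = idm Y ->
  (f' ∘ g' ∘ h') ∘ (h ∘ g ∘ f) = idm W.
Proof.
intros Hf Hg Hh. rewrite <- (compA h g f). apply cancel_comp; [|exact Hh].
apply cancel_comp; [exact Hf | exact Hg].
Qed.

Lemma cancel_tensm (C : monoidal_category) (X Y X' Y' : C)
    (f : Hom X Y) (f' : Hom Y X) (g : Hom X' Y') (g' : Hom Y' X') :
  f' ∘ f = idm X -> g' ∘ g = idm X' ->
  (f' ⊗m g') ∘ (f ⊗m g) = idm (X ⊗ X').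
Proof.
intros Hf Hg. rewrite <- tensm_comp, Hf, Hg. apply tensm1.
Qed.

Lemma assocV_nat (C : monoidal_category) (X X' Y Y' Z Z' : C)
    (f : Hom X X') (g : Hom Y Y') (h : Hom Z Z') :
  assocV X' Y' Z' ∘ (f ⊗m (g ⊗m h)) = ((f ⊗m g) ⊗m h) ∘ assocV X Y Z.
Proof.
rewrite <- (compm1 (f ⊗m (g ⊗m h))), <- (assocVK X Y Z).
rewrite (compA (f ⊗m (g ⊗m h))), <- assoc_nat, !compA, assocK, comp1m.
reflexivity.
Qed.

Lemma pentagonV (C : monoidal_category) (W X Y Z : C) :
  (assocV W X Y ⊗m idm Z) ∘ assocV W (X ⊗ Y) Z ∘ (idm W ⊗m assocV X Y Z)
  = assocV (W ⊗ X) Y Z ∘ assocV W X (Y ⊗ Z).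
Proof.
eapply inv_unique; [| | exact (pentagon W X Y Z)].
- apply cancel_comp3.
  + apply cancel_tensm; [apply assocK | apply comp1m].
  + apply assocK.
  + apply cancel_tensm; [apply comp1m | apply assocK].
- apply cancel_comp; apply assocVK.
Qed.

Lemma triangleV (C : monoidal_category) (X Y : C) :
  (runit X ⊗m idm Y) ∘ assocV X unit_ob Y = idm X ⊗m lunit Y.
Proof. rewrite <- triangle, <- compA, assocVK. apply compm1. Qed.

Definition mon_rev (C : monoidal_category) : monoidal_category :=
  @MonoidalCategory C
    (fun X Y => Y ⊗ X)
    (fun X X' Y Y' f g => g ⊗m f)
    unit_ob
    (fun X Y Z => assocV Z Y X)
    (fun X Y Z => assoc Z Y X)
    (fun X => runit X) (fun X => runitV X)
    (fun X => lunit X) (fun X => lunitV X)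
    (fun X Y => tensm1 Y X)
    (fun X X' X'' Y Y' Y'' f' f g' g => tensm_comp g' g f' f)
    (fun X X' Y Y' Z Z' f g h => assocV_nat h g f)
    (fun X Y f => runit_nat f)
    (fun X Y f => lunit_nat f)
    (fun X Y Z => assocVK Z Y X)
    (fun X Y Z => assocK Z Y X)
    (fun X => runitK X) (fun X => runitVK X)
    (fun X => lunitK X) (fun X => lunitVK X)
    (fun W X Y Z => pentagonV Z Y X W)
    (fun X Y => triangleV Y X).

Definition reversed (C : braided_monoidal_category) : braided_monoidal_category :=
  @BraidedMonoidalCategory (mon_rev C)
    (fun X Y => @braid C Y X)
    (fun X Y => @braidV C Y X)
    (fun X X' Y Y' f g => @braid_nat C Y Y' X X' g f)
    (fun X Y => @braidK C Y X)
    (fun X Y => @braidVK C Y X)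
    (fun X Y Z => @hexagon2 C Z Y X)
    (fun X Y Z => @hexagon1 C Z Y X).

Section InverseBraiding.

Variable C : braided_monoidal_category.

Lemma braidV_nat (X X' Y Y' : C) (f : Hom X X') (g : Hom Y Y') :
  braidV Y' X' ∘ (f ⊗m g) = (g ⊗m f) ∘ braidV Y X.
Proof.
rewrite <- (compm1 (f ⊗m g)), <- (braidVK Y X).
rewrite (compA (f ⊗m g)), <- braid_nat, !compA, braidK, comp1m.
reflexivity.
Qed.

Lemma hexagon1V (X Y Z : C) :
  assoc Y Z X ∘ braidV (Y ⊗ Z) X ∘ assoc X Y Z
  = (idm Y ⊗m braidV Z X) ∘ assoc Y X Z ∘ (braidV Y X ⊗m idm Z).
Proof.
eapply inv_unique; [| | exact (hexagon2 Y Z X)].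
- apply cancel_comp3.
  + apply assocVK.
  + apply braidK.
  + apply assocVK.
- apply cancel_comp3.
  + apply cancel_tensm; [apply braidVK | apply comp1m].
  + apply assocK.
  + apply cancel_tensm; [apply comp1m | apply braidVK].
Qed.

Lemma hexagon2V (X Y Z : C) :
  assocV Z X Y ∘ braidV Z (X ⊗ Y) ∘ assocV X Y Z
  = (braidV Z X ⊗m idm Y) ∘ assocV X Z Y ∘ (idm X ⊗m braidV Z Y).
Proof.
eapply inv_unique; [| | exact (hexagon1 Z X Y)].
- apply cancel_comp3.
  + apply assocK.
  + apply braidK.
  + apply assocK.
- apply cancel_comp3.
  + apply cancel_tensm; [apply comp1m | apply braidVK].
  + apply assocVK.
  + apply cancel_tensm; [apply braidVK | apply comp1m].
Qed.

Definition inverse_braided : braided_monoidal_category :=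
  @BraidedMonoidalCategory C
    (fun X Y => braidV Y X)
    (fun X Y => braid Y X)
    (fun X X' Y Y' f g => braidV_nat f g)
    (fun X Y => braidVK Y X)
    (fun X Y => braidK Y X)
    hexagon1V
    hexagon2V.

End InverseBraiding.

(** A word [X1; ...; Xn] of objects stands for X1 ⊗ (X2 ⊗ (... ⊗ Xn)); in
    particular [] stands for the unit object, [X] for X itself and [X; Y] for
    X ⊗ Y, all definitionally. The product f ⊠ g of morphisms between words is
    f ⊗m g conjugated by the coherence isomorphisms, so that it goes between the
    concatenated words. Concatenations of explicit words are convertible
    whatever their bracketing, so formulas can be written as in a strict
    monoidal category, without assuming C strict. *)

Section Words.

Variable C : monoidal_category.

Fixpoint obj (l : list C) : C :=
  match l with
  | [] => unit_ob
  | X :: l' => match l' with [] => X | _ :: _ => X ⊗ obj l' end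
  end.

Fixpoint word_join (l r : list C) : Hom (obj l ⊗ obj r) (obj (l ++ r)) :=
  match l with
  | [] => lunit (obj r)
  | X :: l' =>
      match l' return Hom (obj l' ⊗ obj r) (obj (l' ++ r)) ->
                      Hom (obj (X :: l') ⊗ obj r) (obj ((X :: l') ++ r)) with
      | [] => fun _ =>
          match r with [] => runit X | Y :: r' => idm (X ⊗ obj (Y :: r')) end
      | Y :: l'' => fun f => (idm X ⊗m f) ∘ assoc X (obj (Y :: l'')) (obj r)
      end (word_join l' r)
  end.

Fixpoint word_split (l r : list C) : Hom (obj (l ++ r)) (obj l ⊗ obj r) :=
  match l with
  | [] => lunitV (obj r)
  | X :: l' =>
      match l' return Hom (obj (l' ++ r)) (obj l' ⊗ obj r) ->
                      Hom (obj ((X :: l') ++ r)) (obj (X :: l') ⊗ obj r) with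
      | [] => fun _ =>
          match r with [] => runitV X | Y :: r' => idm (X ⊗ obj (Y :: r')) end
      | Y :: l'' => fun f => assocV X (obj (Y :: l'')) (obj r) ∘ (idm X ⊗m f)
      end (word_split l' r)
  end.

Lemma word_splitK (l r : list C) : word_join l r ∘ word_split l r = idm _.
Proof.
induction l as [|X [|Y l] IH].
- apply lunitVK.
- destruct r; [apply runitVK | apply comp1m].
- apply cancel_comp; [|apply assocVK].
  apply cancel_tensm; [apply comp1m | exact IH].
Qed.

Lemma word_joinK (l r : list C) : word_split l r ∘ word_join l r = idm _.
Proof.
induction l as [|X [|Y l] IH].
- apply lunitK.
- destruct r; [apply runitK | apply comp1m].
- apply cancel_comp; [apply assocK|].
  apply cancel_tensm; [apply comp1m | exact IH].
Qed.

Definition whom (l l' : list C) : Type := Hom (obj l) (obj l').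

Definition one (X : C) : whom [X] [X] := idm X.

Definition wcomp (l l' l'' : list C) (g : whom l' l'') (f : whom l l') :
  whom l l'' := comp g f.

Definition wtens (l l' r r' : list C) (f : whom l l') (g : whom r r') :
  whom (l ++ r) (l' ++ r') := word_join l' r' ∘ (f ⊗m g) ∘ word_split l r.

End Words.

Arguments one {C} X.
Notation "g ∙ f" := (wcomp g f) (at level 40, left associativity) : cat_scope.
Notation "f ⊠ g" := (wtens f g) (at level 36, right associativity) : cat_scope.

Section NonDegeneracy.

Variable C : braided_monoidal_category.

Definition wbraid (X Y : C) : whom [X; Y] [Y; X] := braid X Y.

Definition wbraidV (X Y : C) : whom [Y; X] [X; Y] := braidV X Y.

Definition nondegenerate_left (Z V W : C) (v : whom [Z; V] [W]) (Ys : C -> Prop) :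
  Prop :=
  forall X Y : C, Ys Y -> forall g g' : whom [X] [V; Y],
    (v ⊠ one Y) ∙ (one Z ⊠ g) = (v ⊠ one Y) ∙ (one Z ⊠ g') -> g = g'.

Definition nondegenerate_right (Z V W : C) (v : whom [Z; V] [W]) (Ys : C -> Prop) :
  Prop :=
  nondegenerate_left (v ∙ wbraid V Z) Ys.

Definition nondegenerate (A : C) (m : whom [A; A] [A]) (Ys : C -> Prop) : Prop :=
  nondegenerate_left m Ys /\ nondegenerate_right m Ys.

End NonDegeneracy.

Section Fusion.

Variables (C : braided_monoidal_category) (A : C).

Definition mult (t : whom [A; A] [A; A]) (j : whom [A] []) : whom [A; A] [A] :=
  (j ⊠ one A) ∙ t.

Local Notation "1" := (one A) : cat_scope.
Local Notation c := (wbraid A A).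
Local Notation cV := (wbraidV A A).

Record weakly_counital_fusion (t e : whom [A; A] [A; A]) (j : whom [A] []) :
  Prop := {
  wcf_fusion :
    (t ⊠ 1) ∙ (cV ⊠ 1) ∙ (1 ⊠ t) ∙ (c ⊠ 1) ∙ (1 ⊠ t) = (1 ⊠ t) ∙ (t ⊠ 1);
  wcf_idem : e ∙ e = e;
  wcf_et : e ∙ t = t;
  wcf_absorb :
    (mult t j ⊠ 1) ∙ (1 ⊠ c) ∙ (t ⊠ 1) ∙ (1 ⊠ cV) ∙ (1 ⊠ e)
    = (mult t j ⊠ 1) ∙ (1 ⊠ c) ∙ (t ⊠ 1) ∙ (1 ⊠ cV);
  wcf_comm : (e ⊠ 1) ∙ (1 ⊠ t) = (1 ⊠ t) ∙ (e ⊠ 1);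
  wcf_te : (t ⊠ 1) ∙ (1 ⊠ c) ∙ (e ⊠ 1) ∙ (1 ⊠ cV) = (1 ⊠ e) ∙ (t ⊠ 1);
  wcf_counit1 :
    mult t j ∙ (1 ⊠ j ⊠ 1) ∙ (t ⊠ 1)
    = mult t j ∙ (1 ⊠ 1 ⊠ j) ∙ (1 ⊠ e) ∙ (1 ⊠ c);
  wcf_counit2 :
    (j ⊠ 1) ∙ (mult t j ⊠ 1) ∙ (1 ⊠ c) ∙ (t ⊠ 1)
    = mult t j ∙ (1 ⊠ j ⊠ 1) ∙ (1 ⊠ e) ∙ (1 ⊠ c) }.

End Fusion.

Section RegularWeakMultiplierBimonoid.

Variables (C : braided_monoidal_category) (A : C).

Local Notation "1" := (one A) : cat_scope.
Local Notation c := (wbraid A A).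
Local Notation cV := (wbraidV A A).

Record regular_weak_multiplier_bimonoid
    (t1 t2 t3 t4 e1 e2 : whom [A; A] [A; A]) (j : whom [A] [])
    (m := mult t1 j) : Prop := {
  rwmb_nondegenerate : exists Ys : C -> Prop,
    Ys unit_ob /\ Ys A /\ Ys (A ⊗ A) /\ nondegenerate m Ys;

  rwmb_12 : (m ⊠ 1) ∙ (1 ⊠ t1) = (1 ⊠ m) ∙ (t2 ⊠ 1);
  rwmb_13 : (1 ⊠ m) ∙ (1 ⊠ cV) ∙ (t1 ⊠ 1) = (1 ⊠ m) ∙ (t3 ⊠ 1) ∙ (1 ⊠ cV);
  rwmb_14 : (m ⊠ 1) ∙ (cV ⊠ 1) ∙ (1 ⊠ t1) = (1 ⊠ m) ∙ (t4 ⊠ 1);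
  rwmb_23 : (1 ⊠ m) ∙ (1 ⊠ cV) ∙ (t2 ⊠ 1) = (m ⊠ 1) ∙ (1 ⊠ t3);
  rwmb_24 : (m ⊠ 1) ∙ (cV ⊠ 1) ∙ (1 ⊠ t2) = (m ⊠ 1) ∙ (1 ⊠ t4) ∙ (cV ⊠ 1);
  rwmb_34 : (m ⊠ 1) ∙ (cV ⊠ 1) ∙ (1 ⊠ t3) = (1 ⊠ m) ∙ (1 ⊠ cV) ∙ (t4 ⊠ 1);

  rwmb_comm21 : (t2 ⊠ 1) ∙ (1 ⊠ t1) = (1 ⊠ t1) ∙ (t2 ⊠ 1);
  rwmb_comm23 : (t2 ⊠ 1) ∙ (1 ⊠ t3) = (1 ⊠ t3) ∙ (t2 ⊠ 1);
  rwmb_comm41 : (t4 ⊠ 1) ∙ (1 ⊠ t1) = (1 ⊠ t1) ∙ (t4 ⊠ 1);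
  rwmb_comm43 : (t4 ⊠ 1) ∙ (1 ⊠ t3) = (1 ⊠ t3) ∙ (t4 ⊠ 1);

  rwmb_m2 : m = (1 ⊠ j) ∙ t2;
  rwmb_m3 : m = (j ⊠ 1) ∙ t3 ∙ c;
  rwmb_m4 : m = (1 ⊠ j) ∙ t4 ∙ c;

  rwmb_e12 : (m ⊠ m) ∙ (1 ⊠ c ⊠ 1) ∙ (1 ⊠ 1 ⊠ e1)
             = (m ⊠ m) ∙ (1 ⊠ c ⊠ 1) ∙ (e2 ⊠ 1 ⊠ 1);

  (* A has the same square and the unit object is the same in all four
     categories, so the types of the data agree up to conversion *)
  rwmb_fusion1 : @weakly_counital_fusion C A t1 e1 j;
  rwmb_fusion2 : @weakly_counital_fusion (reversed C) A t2 e2 j;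
  rwmb_fusion3 : @weakly_counital_fusion (inverse_braided C) A t3 e2 j;
  rwmb_fusion4 : @weakly_counital_fusion (reversed (inverse_braided C)) A t4 e1 j }.

End RegularWeakMultiplierBimonoid.

Section Comonoids.

Variables (C : monoidal_category) (L : C).

Definition associative (mu : whom [L; L] [L]) : Prop :=
  mu ∙ (mu ⊠ one L) = mu ∙ (one L ⊠ mu).

Definition coassociative (delta : whom [L] [L; L]) : Prop :=
  (delta ⊠ one L) ∙ delta = (one L ⊠ delta) ∙ delta.

Definition counital (delta : whom [L] [L; L]) (eps : whom [L] []) : Prop :=
  (eps ⊠ one L) ∙ delta = one L /\ (one L ⊠ eps) ∙ delta = one L.

Definition frobenius (mu : whom [L; L] [L]) (delta : whom [L] [L; L]) : Prop :=
  (mu ⊠ one L) ∙ (one L ⊠ delta) = delta ∙ mu /\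
  delta ∙ mu = (one L ⊠ mu) ∙ (delta ⊠ one L).

Definition comonoid (delta : whom [L] [L; L]) (eps : whom [L] []) : Prop :=
  coassociative delta /\ counital delta eps.

Definition coseparable_comonoid (delta : whom [L] [L; L]) (eps : whom [L] []) :
  Prop :=
  comonoid delta eps /\
  exists mu : whom [L; L] [L], mu ∙ delta = one L /\ frobenius mu delta.

End Comonoids.

(* Main.v *)
Require Import Defs.
From Stdlib Require Import List Arith Lia Bool Eqdep_dec.
Import ListNotations.
Local Open Scope cat_scope.

(** The proof becomes transparent in the notation of multiplier algebras: read
    [t1] as a ⊗ b ↦ Δ(a)(1 ⊗ b) for a multiplier-valued comultiplication
    Δ(a) = a' ⊗ a'', read [e1] as the multiplication by an idempotent E = E' ⊗ E'',
    and [j] as the counit ε. Then p(a) stands for the multiplier ε(E'a)E'', the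
    morphism [n1] is the action of such multipliers on A, the wanted product is
    their composition, and the wanted coproduct sends p(a) to p(a') ⊗ p(a'').

    The axiom [wcf_counit2] says w p(z) d = ε(w'z) w''d. As [m] and [n1] are non-degenerate,
    p(z) is therefore determined by the functional w ↦ ε(wz)
    ([base_map_determined]), and identities that hold under [p] reduce to
    identities under [j ∙ m]. The basic one is ε(w p(a)b) = ε(w E'a)ε(E''b)
    ([counit_mult_s_r]): by the two counit axioms, both are ε(w'a)ε(w''b). Three
    consequences carry the construction.

    - The element p(p(a)b) depends on b only through p(b) ([p_s_s]); so there is
      a product with p(a)p(b) = p(p(a)b), and [s_assoc] makes it associative and
      [n1] an action.
    - One has p(a') ⊗ p(a''b)c = p(E'ab) ⊗ E''c ([p_s_t1]), and the right hand side
      depends on ab only through p(ab) ([p_e1_s]). Hence (p ⊗ p)Δ(a)(1 ⊗ b), made to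
      act on c, is a function of p(ab). As [p ∙ m] is a regular epimorphism, the
      non-degeneracy of [n1] turns this into the existence of the coproduct.
    - Writing the coproduct of p(a)p(b) as p(E'a) ⊗ p(E''b) ([delta_mu_p_p])
      gives its right linearity; left linearity is the compatibility of [t1]
      with p(a) in its first factor ([t1_s_left]).

    Coassociativity, counitality and μδ = 1 follow by cancelling [p] and [m].

    All calculations are equalities of string diagrams in a braided category, and
    the first half of the file automates them. A morphism
    between explicit words is cut into layers, each applying one generating
    morphism at one position. Layers at disjoint positions commute, which gives
    a normal form modulo the axioms of a strict monoidal category; coherence is
    dealt with once, in [lift_tens]. The tactic [diag (H1, ..., Hk)] proves f = g if g
    arises from f by rewriting once with each Hi, from left to right, in this
    order and anywhere in the diagram, modulo exchange of layers. A calculation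
    is thus a list of the equations that it uses. *)

(** * Words of objects as stacks *)

Section Calculus.

Variables (C : monoidal_category) (ob : nat -> C).

Local Notation code := (list nat).
Local Notation whom' u v := (@whom C (map ob u) (map ob v)).

(** Objects are coded by numbers so that words have decidable equality. Unlike
    [obj], a stack ends with the unit object, so that adding an object on the
    left is the same operation for all words. *)
Fixpoint stack (w : code) : C :=
  match w with [] => unit_ob | x :: w' => ob x ⊗ stack w' end.

Fixpoint stack_join (u w : code) : Hom (obj (map ob u) ⊗ stack w) (stack (u ++ w)) :=
  match u with
  | [] => lunit (stack w)
  | x :: u' =>
      match u' return Hom (obj (map ob u') ⊗ stack w) (stack (u' ++ w)) ->
                      Hom (obj (map ob (x :: u')) ⊗ stack w) (stack ((x :: u') ++ w)) with
      | [] => fun _ => idm _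
      | y :: u'' => fun f => (idm (ob x) ⊗m f) ∘ assoc _ _ _
      end (stack_join u' w)
  end.

Fixpoint stack_split (u w : code) : Hom (stack (u ++ w)) (obj (map ob u) ⊗ stack w) :=
  match u with
  | [] => lunitV (stack w)
  | x :: u' =>
      match u' return Hom (stack (u' ++ w)) (obj (map ob u') ⊗ stack w) ->
                      Hom (stack ((x :: u') ++ w)) (obj (map ob (x :: u')) ⊗ stack w) with
      | [] => fun _ => idm _
      | y :: u'' => fun f => assocV _ _ _ ∘ (idm (ob x) ⊗m f)
      end (stack_split u' w)
  end.

Lemma stack_joinK (u w : code) : stack_split u w ∘ stack_join u w = idm _.
Proof.
induction u as [|x [|y u] IH].
- apply lunitK.
- apply comp1m.
- apply cancel_comp; [apply assocK|].
  apply cancel_tensm; [apply comp1m | exact IH].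
Qed.

Lemma stack_splitK (u w : code) : stack_join u w ∘ stack_split u w = idm _.
Proof.
induction u as [|x [|y u] IH].
- apply lunitVK.
- apply comp1m.
- apply cancel_comp; [|apply assocVK].
  apply cancel_tensm; [apply comp1m | exact IH].
Qed.

Fixpoint whisker (l : code) (w w' : code) (f : Hom (stack w) (stack w')) :
    Hom (stack (l ++ w)) (stack (l ++ w')) :=
  match l with
  | [] => f
  | x :: l' => idm (ob x) ⊗m whisker l' w w' f
  end.
Arguments whisker l {w w'} f.

Lemma tens1_comp (X Y Y' Y'' : C) (g : Hom Y' Y'') (f : Hom Y Y') :
  idm X ⊗m (g ∘ f) = (idm X ⊗m g) ∘ (idm X ⊗m f).
Proof. rewrite <- tensm_comp, comp1m. reflexivity. Qed.

Lemma tens_comp1 (X Y Y' Y'' : C) (g : Hom Y' Y'') (f : Hom Y Y') :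
  (g ∘ f) ⊗m idm X = (g ⊗m idm X) ∘ (f ⊗m idm X).
Proof. rewrite <- tensm_comp, comp1m. reflexivity. Qed.

Lemma interchange (X X' Y Y' : C) (f : Hom X X') (g : Hom Y Y') :
  (f ⊗m idm Y') ∘ (idm X ⊗m g) = (idm X' ⊗m g) ∘ (f ⊗m idm Y).
Proof. rewrite <- !tensm_comp, !comp1m, !compm1. reflexivity. Qed.

Lemma whisker1 (l w : code) : whisker l (idm (stack w)) = idm (stack (l ++ w)).
Proof.
induction l as [|x l IH]; [reflexivity|]. simpl. rewrite IH. apply tensm1.
Qed.

Lemma whisker_comp (l w w' w'' : code) (g : Hom (stack w') (stack w'')) (f : Hom (stack w) (stack w')) :
  whisker l (g ∘ f) = whisker l g ∘ whisker l f.
Proof.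
induction l as [|x l IH]; [reflexivity|]. simpl. rewrite IH. apply tens1_comp.
Qed.

(** The inductive step of [stack_join_nat] for abstract objects, where no word
    stands in the way of rewriting. *)
Lemma assoc_step_nat (X U V V' P P' : C) (j : Hom (U ⊗ V) P) (j' : Hom (U ⊗ V') P')
    (f : Hom V V') (g : Hom P P') :
  j' ∘ (idm U ⊗m f) = g ∘ j ->
  (idm X ⊗m j') ∘ assoc X U V' ∘ (idm (X ⊗ U) ⊗m f)
  = (idm X ⊗m g) ∘ ((idm X ⊗m j) ∘ assoc X U V).
Proof.
intros H. rewrite <- tensm1, <- compA, assoc_nat, !compA, <- !tens1_comp, H.
reflexivity.
Qed.

Lemma stack_join_nat (u w w' : code) (f : Hom (stack w) (stack w')) :
  stack_join u w' ∘ (idm _ ⊗m f) = whisker u f ∘ stack_join u w.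
Proof.
induction u as [|x [|y u] IH].
- apply lunit_nat.
- simpl. rewrite comp1m, compm1. reflexivity.
- apply assoc_step_nat, IH.
Qed.

(** The action of a morphism on the top of a stack. It turns the non-strict
    composite and product of words into strict ones: see [lift_comp] and
    [lift_tens]. *)
Definition lift (u v : code) (f : whom' u v) (w : code) : Hom (stack (u ++ w)) (stack (v ++ w)) :=
  stack_join v w ∘ ((f : Hom _ _) ⊗m idm (stack w)) ∘ stack_split u w.
Arguments lift {u v} f w.

Lemma stack_split_nat (u w w' : code) (f : Hom (stack w) (stack w')) :
  stack_split u w' ∘ whisker u f = (idm _ ⊗m f) ∘ stack_split u w.
Proof.
rewrite <- (compm1 (_ ∘ whisker u f)), <- (stack_splitK u w).
rewrite <- !compA, (compA (whisker u f)), <- stack_join_nat, !compA, stack_joinK, comp1m.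
reflexivity.
Qed.

(** The exchange law: a morphism on the top of a stack, its left end, commutes
    with one that happens below it. *)
Lemma lift_nat (u v w w' : code) (f : whom' u v) (g : Hom (stack w) (stack w')) :
  lift f w' ∘ whisker u g = whisker v g ∘ lift f w.
Proof.
unfold lift. rewrite <- !compA, stack_split_nat, !compA, <- stack_join_nat.
rewrite <- (compA (stack_join v w')), interchange, !compA. reflexivity.
Qed.

Lemma lift1 (u w : code) : lift (idm (obj (map ob u))) w = idm (stack (u ++ w)).
Proof. unfold lift. rewrite tensm1, compm1. apply stack_splitK. Qed.

Lemma lift_comp (u v x w : code) (g : whom' v x) (f : whom' u v) :
  lift (g ∙ f) w = lift g w ∘ lift f w.
Proof.
unfold lift, wcomp. rewrite tens_comp1.
rewrite !compA, <- (compA _ (stack_split v w) (stack_join v w)), stack_joinK, compm1.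
reflexivity.
Qed.

Lemma cancel_iso (X Y Z : C) (f g : Hom Y Z) (h : Hom X Y) (h' : Hom Y X) :
  h ∘ h' = idm Y -> f ∘ h = g ∘ h -> f = g.
Proof.
intros K H. rewrite <- (compm1 f), <- (compm1 g), <- K, !compA, H. reflexivity.
Qed.

Lemma conj_inj (X X' Y Y' : C) (f g : Hom X Y) (i : Hom Y Y') (i' : Hom Y' Y)
    (h : Hom X' X) (h' : Hom X X') :
  i' ∘ i = idm Y -> h ∘ h' = idm X -> i ∘ f ∘ h = i ∘ g ∘ h -> f = g.
Proof.
intros Hi Hh H.
rewrite <- (compm1 f), <- (compm1 g), <- Hh, <- (comp1m f), <- (comp1m g), <- Hi.
apply (f_equal (fun k => i' ∘ k ∘ h')) in H. rewrite !compA in *. exact H.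
Qed.

(** No equation is lost by passing to stacks. *)
Lemma lift_inj (u v : code) (f g : whom' u v) : lift f [] = lift g [] -> f = g.
Proof.
intros H. apply (conj_inj _ _ _ _ _ _ _ _ _ _ (stack_joinK v []) (stack_joinK u [])) in H.
apply (conj_inj _ _ _ _ f g (idm _) (idm _) (runit _) (runitV _));
  [apply comp1m | apply runitVK |].
rewrite !comp1m. change (comp f (runit _) = comp g (runit (obj (map ob u)))).
rewrite <- !runit_nat. apply f_equal, H.
Qed.

(** Concatenation of words is associative only up to a propositional equality.
    Casting along it by a morphism keeps the casts within the category, where
    they compose and cancel. *)
Definition stack_cast (u v : code) (e : u = v) : Hom (stack u) (stack v) :=
  match e in _ = x return Hom (stack u) (stack x) with eq_refl => idm _ end.
Arguments stack_cast {u v} e.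

Lemma stack_cast_id (u : code) (e : u = u) : stack_cast e = idm _.
Proof.
rewrite (UIP_dec (list_eq_dec Nat.eq_dec) e eq_refl). reflexivity.
Qed.

Lemma stack_cast_cons (x : nat) (u v : code) (e : u = v) (e' : x :: u = x :: v) :
  stack_cast e' = idm (ob x) ⊗m stack_cast e.
Proof.
destruct e. rewrite stack_cast_id. cbn. rewrite tensm1. reflexivity.
Qed.

(** Transparent, so that it computes to [eq_refl] on explicit words. *)
Fixpoint word_app (u v : code) : map ob u ++ map ob v = map ob (u ++ v) :=
  match u with
  | [] => eq_refl
  | x :: u' => f_equal (cons (ob x)) (word_app u' v)
  end.

Definition transport (u u' v v' : list C) (e : u = u') (e' : v = v') (f : whom u v) :
    whom u' v' :=
  match e in _ = x, e' in _ = y return whom x y with eq_refl, eq_refl => f end.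

Definition code_tens (u v u' v' : code) (f : whom' u v) (g : whom' u' v') :
    whom' (u ++ u') (v ++ v') :=
  transport _ _ _ _ (word_app u u') (word_app v v') (f ⊠ g).

Definition word_cast (u v : list C) (e : u = v) : Hom (obj u) (obj v) :=
  match e in _ = x return Hom (obj u) (obj x) with eq_refl => idm _ end.

Lemma transport_cast (u u' v v' : list C) (e : u = u') (e' : v = v') (f : whom u v) :
  transport _ _ _ _ e e' f = word_cast _ _ e' ∘ (f : Hom _ _) ∘ word_cast _ _ (eq_sym e).
Proof. destruct e, e'. cbn. rewrite compm1, comp1m. reflexivity. Qed.

Definition code_join (u v : code) : Hom (obj (map ob u) ⊗ obj (map ob v)) (obj (map ob (u ++ v))) :=
  word_cast _ _ (word_app u v) ∘ word_join (map ob u) (map ob v).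
Definition code_split (u v : code) : Hom (obj (map ob (u ++ v))) (obj (map ob u) ⊗ obj (map ob v)) :=
  word_split (map ob u) (map ob v) ∘ word_cast _ _ (eq_sym (word_app u v)).

Lemma code_tens_join (u v u' v' : code) (f : whom' u v) (g : whom' u' v') :
  code_tens _ _ _ _ f g = code_join v v' ∘ ((f : Hom _ _) ⊗m (g : Hom _ _)) ∘ code_split u u'.
Proof.
unfold code_tens, code_join, code_split. rewrite transport_cast. unfold wtens.
rewrite !compA. reflexivity.
Qed.

Lemma word_castK (u v : list C) (e : u = v) : word_cast _ _ (eq_sym e) ∘ word_cast _ _ e = idm _.
Proof. destruct e. apply comp1m. Qed.

Lemma code_joinK (u v : code) : code_split u v ∘ code_join u v = idm _.
Proof.
unfold code_split, code_join. rewrite compA, <- (compA (word_split _ _)), word_castK, compm1.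
apply word_joinK.
Qed.

(** [obj] adds an object uniformly only to non-empty words, hence the [Y] and
    [Y']. *)
Lemma word_cast_cons (X : C) (Y Y' : C) (u v : list C) (e : Y :: u = Y' :: v) :
  word_cast (X :: Y :: u) (X :: Y' :: v) (f_equal (cons X) e) = idm X ⊗m word_cast _ _ e.
Proof.
refine (match e as e0 in _ = x return
  match x return Y :: u = x -> Prop with
  | [] => fun _ => True
  | Z :: t => fun e => word_cast (X :: Y :: u) (X :: Z :: t) (f_equal (cons X) e) = idm X ⊗m word_cast _ _ e
  end e0 with eq_refl => _ end).
cbn. rewrite tensm1. reflexivity.
Qed.

(** Kelly's redundancy of the unit axioms: it suffices to compare both sides
    after tensoring with the unit, and there the pentagon and the triangle
    reduce them to the same morphism. *)
Lemma lunit_tens (X Y : C) : lunit (X ⊗ Y) ∘ assoc unit_ob X Y = lunit X ⊗m idm Y.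
Proof.
assert (inj : forall (U V : C) (f g : Hom U V),
  idm (@unit_ob C) ⊗m f = idm unit_ob ⊗m g -> f = g).
{ intros U V f g H.
  rewrite <- (compm1 f), <- (compm1 g), <- (lunitVK U), !compA, <- !lunit_nat, H.
  reflexivity. }
apply inj. rewrite tens1_comp.
apply (cancel_iso _ _ _ _ _ (assoc unit_ob (unit_ob ⊗ X) Y) _ (assocVK _ _ _)).
apply (cancel_iso _ _ _ _ _ (assoc unit_ob unit_ob X ⊗m idm Y) (assocV _ _ _ ⊗m idm Y)).
{ apply cancel_tensm; [apply assocVK | apply comp1m]. }
rewrite <- !compA, (compA _ (assoc unit_ob (unit_ob ⊗ X) Y)), pentagon.
rewrite !compA, triangle, <- assoc_nat, <- !compA, <- tens_comp1, triangle.
rewrite <- tensm1, assoc_nat. reflexivity.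
Qed.

(** The inductive step of [stack_join_word] for abstract objects; this is where
    the pentagon enters. *)
Lemma assoc_step_assoc (X U V Y P Q R S : C) (j : Hom (U ⊗ V) P) (i : Hom (P ⊗ Y) Q)
    (k : Hom (V ⊗ Y) R) (l : Hom (U ⊗ R) S) (c : Hom S Q) :
  i ∘ (j ⊗m idm Y) = c ∘ l ∘ (idm U ⊗m k) ∘ assoc U V Y ->
  (idm X ⊗m i) ∘ assoc X P Y ∘ (((idm X ⊗m j) ∘ assoc X U V) ⊗m idm Y)
  = (idm X ⊗m c) ∘ ((idm X ⊗m l) ∘ assoc X U R) ∘ (idm (X ⊗ U) ⊗m k)
      ∘ assoc (X ⊗ U) V Y.
Proof.
intros H. rewrite tens_comp1, compA, <- (compA _ (assoc X P Y)), assoc_nat.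
rewrite !compA, <- tens1_comp, H, !tens1_comp, <- (tensm1 X U).
rewrite <- !compA, (compA (assoc X U R)), assoc_nat, <- !compA.
rewrite <- pentagon, !compA. reflexivity.
Qed.

(** The coherence behind [lift_tens]: putting two words on a stack at once or
    one after the other is the same. *)
Lemma stack_join_word (u v w : code) (e : u ++ (v ++ w) = (u ++ v) ++ w) :
  stack_join (u ++ v) w ∘ (code_join u v ⊗m idm (stack w)) =
  stack_cast e ∘ stack_join u (v ++ w) ∘ (idm _ ⊗m stack_join v w) ∘ assoc _ _ _.
Proof.
revert e. induction u as [|x [|y u] IH]; intros e.
- rewrite stack_cast_id, comp1m. unfold code_join. cbn [word_app word_cast word_join map stack_join app].
  rewrite comp1m, lunit_nat, <- compA, lunit_tens. reflexivity.
- rewrite stack_cast_id, comp1m. destruct v as [|y v].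
  + unfold code_join. cbn. rewrite !comp1m, triangle. reflexivity.
  + unfold code_join.
    change (word_app [x] (y :: v)) with (@eq_refl _ (map ob (x :: y :: v))).
    cbn [word_cast word_join map].
    rewrite comp1m.
    change (stack_join ([x] ++ y :: v) w) with
     ((idm (ob x) ⊗m stack_join (y :: v) w) ∘ assoc (ob x) (obj (map ob (y :: v))) (stack w)).
    change (stack_join [x] ((y :: v) ++ w)) with (idm (ob x ⊗ stack ((y :: v) ++ w))).
    rewrite comp1m, tensm1, compm1. reflexivity.
- assert (e' : (y :: u) ++ v ++ w = ((y :: u) ++ v) ++ w) by apply app_assoc.
  specialize (IH e').
  assert (Ec : stack_cast e = idm (ob x) ⊗m stack_cast e') by exact (stack_cast_cons x _ _ e' e).
  rewrite Ec; clear Ec.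
  assert (Ej : code_join (x :: y :: u) v = (idm (ob x) ⊗m code_join (y :: u) v) ∘
     assoc (ob x) (obj (map ob (y :: u))) (obj (map ob v))).
  { unfold code_join.
    etransitivity; [|symmetry; etransitivity;
      [apply (f_equal (fun h => h ∘ _)); apply tens1_comp | symmetry; apply compA]].
    apply (f_equal (fun h => h ∘ _)).
    exact (word_cast_cons _ _ _ _ _ (word_app (y :: u) v)). }
  rewrite Ej. apply assoc_step_assoc, IH.
Qed.

Lemma stack_cast_sym (u v : code) (e : u = v) (e' : v = u) : stack_cast e' ∘ stack_cast e = idm _.
Proof. destruct e. rewrite !stack_cast_id. apply comp1m. Qed.

Lemma lift_stack_join (u v w : code) (f : whom' u v) :
  lift f w ∘ stack_join u w = stack_join v w ∘ ((f : Hom _ _) ⊗m idm (stack w)).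
Proof. unfold lift. rewrite <- !compA, stack_joinK, compm1. reflexivity. Qed.

Lemma lift_tens (u v u' v' w : code) (f : whom' u v) (g : whom' u' v')
    (e : (u ++ u') ++ w = u ++ (u' ++ w)) (e' : v ++ (v' ++ w) = (v ++ v') ++ w) :
  lift (code_tens _ _ _ _ f g) w =
  stack_cast e' ∘ (lift f (v' ++ w) ∘ whisker u (lift g w)) ∘ stack_cast e.
Proof.
apply (cancel_iso _ _ _ _ _ (stack_join (u ++ u') w ∘ (code_join u u' ⊗m idm _))
         ((code_split u u' ⊗m idm _) ∘ stack_split (u ++ u') w)).
{ apply cancel_comp; [apply stack_splitK|].
  apply cancel_tensm; [|apply comp1m].
  unfold code_join, code_split. apply cancel_comp; [|apply word_splitK].
  destruct (word_app u u'). apply comp1m. }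
rewrite compA, lift_stack_join, <- compA, <- tens_comp1, code_tens_join.
rewrite <- (compA _ (code_split u u')), code_joinK, compm1, tens_comp1, compA.
rewrite (stack_join_word v v' w e'), (stack_join_word u u' w (eq_sym e)).
assert (E : lift f (v' ++ w) ∘ whisker u (lift g w) ∘ stack_join u (u' ++ w) ∘ (idm _ ⊗m stack_join u' w)
  = stack_join v (v' ++ w) ∘ (idm _ ⊗m stack_join v' w) ∘ ((f : Hom _ _) ⊗m ((g : Hom _ _) ⊗m idm (stack w)))).
{ rewrite <- (compA _ (whisker u _)), <- stack_join_nat, !compA, lift_stack_join.
  rewrite <- !compA, <- tensm_comp, lift_stack_join, <- !tensm_comp.
  rewrite !comp1m, compm1. reflexivity. }
rewrite !compA, <- (compA _ (stack_cast e)), stack_cast_sym, compm1.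
rewrite <- (compA _ (assoc _ _ _)), assoc_nat.
rewrite !compA, <- !(compA (stack_cast e')), E. reflexivity.
Qed.

(** * Diagrams as lists of layers *)

Record gen := Gen { gdom : code; gcod : code; gsem : whom' gdom gcod }.

Variable gens : list gen.

Definition get (i : nat) : gen :=
  nth i gens (Gen [] [] (idm (@unit_ob C))).

Notation mor w := {w' : code & Hom (stack w) (stack w')}.

Lemma existT_inj (w0 w : code) (f g : Hom (stack w0) (stack w)) :
  existT (fun w' => Hom (stack w0) (stack w')) w f = existT _ w g -> f = g.
Proof. apply (inj_pair2_eq_dec _ (list_eq_dec Nat.eq_dec)). Qed.

Lemma Some_existT_inj (w0 w : code) (f g : Hom (stack w0) (stack w)) :
  Some (existT (fun w' => Hom (stack w0) (stack w')) w f) = Some (existT _ w g) -> f = g.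
Proof. intros H. injection H as H. exact (existT_inj _ _ _ _ H). Qed.

Fixpoint strip (u w : code) : option {r : code | w = u ++ r} :=
  match u return option {r : code | w = u ++ r} with
  | [] => Some (exist _ w eq_refl)
  | x :: u' =>
      match w return option {r : code | w = (x :: u') ++ r} with
      | [] => None
      | y :: w' =>
          match Nat.eq_dec y x, strip u' w' with
          | left e, Some (exist _ r e') => Some (exist _ r (f_equal2 cons e e'))
          | _, _ => None
          end
      end
  end.

Lemma strip_app (u r : code) : exists e, strip u (u ++ r) = Some (exist _ r e).
Proof.
induction u as [|x u [e IH]]; [exists eq_refl; reflexivity|].
cbn. destruct (Nat.eq_dec x x) as [d|n]; [|destruct (n eq_refl)].
rewrite IH. eexists. reflexivity.
Qed.

(** The generator [i] applied at position [n], to the right of [n] objects. The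
    stack goes on behind its inputs, so that whiskering on the right is
    implicit. *)
Fixpoint layer (n i : nat) (w : code) : option (mor w) :=
  match n with
  | 0 =>
      match strip (gdom (get i)) w with
      | Some (exist _ r e) =>
          Some (existT _ (gcod (get i) ++ r) (lift (gsem (get i)) r ∘ stack_cast e))
      | None => None
      end
  | S n' =>
      match w with
      | [] => None
      | x :: w' =>
          match layer n' i w' with
          | Some (existT _ w'' f) => Some (existT _ (x :: w'') (idm (ob x) ⊗m f))
          | None => None
          end
      end
  end.

Lemma layer0 (i : nat) (r : code) :
  layer 0 i (gdom (get i) ++ r) = Some (existT _ (gcod (get i) ++ r) (lift (gsem (get i)) r)).
Proof.
cbn. destruct (strip_app (gdom (get i)) r) as [e ->].
rewrite stack_cast_id, compm1. reflexivity.
Qed.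

Lemma layer0_inv (i : nat) (w w' : code) (f : Hom (stack w) (stack w')) :
  layer 0 i w = Some (existT _ w' f) -> exists r, w = gdom (get i) ++ r.
Proof.
cbn. destruct (strip _ _) as [[r e]|]; [|discriminate]. intros _. exists r. exact e.
Qed.

Lemma layer_left (l : code) (n i : nat) (w w' : code) (f : Hom (stack w) (stack w')) :
  layer n i w = Some (existT _ w' f) ->
  layer (length l + n) i (l ++ w) = Some (existT _ (l ++ w') (whisker l f)).
Proof.
intros H. induction l as [|x l IH]; [exact H|]. cbn. rewrite IH. reflexivity.
Qed.

(** A layer at a position beyond [u] leaves [u] alone. *)
Lemma layer_left_inv (u : code) (n i : nat) (r w : code) (f : Hom (stack w) (stack (u ++ r))) :
  layer n i w = Some (existT _ (u ++ r) f) -> length u <= n ->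
  exists (r0 : code) (g : Hom (stack r0) (stack r)),
    w = u ++ r0 /\ layer (n - length u) i r0 = Some (existT _ r g).
Proof.
revert n w f. induction u as [|x u IH]; intros n w f H Hn.
- exists w, f. rewrite Nat.sub_0_r. split; [reflexivity | exact H].
- destruct n as [|n]; [inversion Hn|]. destruct w as [|y w]; [discriminate|].
  cbn in H. destruct (layer n i w) as [[w'' g]|] eqn:E; [|discriminate].
  assert (Ew : y :: w'' = x :: u ++ r) by (injection H; congruence).
  injection Ew as -> ->.
  assert (Hn' : length u <= n) by (cbn in Hn; lia).
  destruct (IH n w g E Hn') as (r0 & h & -> & Hh).
  exists r0, h. split; [reflexivity | exact Hh].
Qed.

(** Pairs of a position and a generator, the first layer applied first. *)
Definition diagram := list (nat * nat).

Fixpoint run (d : diagram) (w : code) : option (mor w) :=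
  match d with
  | [] => Some (existT _ w (idm _))
  | (n, i) :: d' =>
      match layer n i w with
      | Some (existT _ w1 f) =>
          match run d' w1 with
          | Some (existT _ w2 g) => Some (existT _ w2 (g ∘ f))
          | None => None
          end
      | None => None
      end
  end.

Lemma run_app (d d' : diagram) (w : code) :
  run (d ++ d') w =
  match run d w with
  | Some (existT _ w1 f) =>
      match run d' w1 with
      | Some (existT _ w2 g) => Some (existT _ w2 (g ∘ f))
      | None => None
      end
  | None => None
  end.
Proof.
revert w. induction d as [|[n i] d IH]; intros w; cbn [run app].
- destruct (run d' w) as [[w2 g]|]; [rewrite compm1|]; reflexivity.
- destruct (layer n i w) as [[w0 h]|]; [|reflexivity].
  rewrite IH. destruct (run d w0) as [[w1 f]|]; [|reflexivity].
  destruct (run d' w1) as [[w2 g]|]; [rewrite compA|]; reflexivity.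
Qed.

Definition shift (k : nat) (d : diagram) : diagram := map (fun l => (k + fst l, snd l)) d.

Lemma run_left (l : code) (d : diagram) (w w' : code) (f : Hom (stack w) (stack w')) :
  run d w = Some (existT _ w' f) ->
  run (shift (length l) d) (l ++ w) = Some (existT _ (l ++ w') (whisker l f)).
Proof.
revert w f. induction d as [|[n i] d IH]; intros w f H.
- cbn in *. injection H as -> H. apply existT_inj in H.
  subst f. rewrite whisker1. reflexivity.
- cbn in H. destruct (layer n i w) as [[w0 h]|] eqn:E; [|discriminate].
  destruct (run d w0) as [[w3 k]|] eqn:E'; [|discriminate].
  injection H as <- H.
  change (shift (length l) ((n, i) :: d)) with ((length l + n, i) :: shift (length l) d).
  cbn [run]. rewrite (layer_left _ _ _ _ _ _ E), (IH _ _ E'). apply existT_inj in H.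
  subst f. rewrite whisker_comp. reflexivity.
Qed.

Definition arity (i : nat) : nat := length (gdom (get i)).
Definition coarity (i : nat) : nat := length (gcod (get i)).

(** A layer acting to the left of the preceding one can be applied before it;
    the preceding one then moves by the change of width. *)
Lemma exchange (k h n i : nat) (d : diagram) (w : code) (r : mor w) :
  k + arity h <= n ->
  run ((n, i) :: (k, h) :: d) w = Some r ->
  run ((k, h) :: (n - arity h + coarity h, i) :: d) w = Some r.
Proof.
intros Hk H.
assert (key : forall (k n : nat) (w w1 w2 : code) (f : Hom (stack w) (stack w1)) (g : Hom (stack w1) (stack w2)),
  k + arity h <= n ->
  layer n i w = Some (existT _ w1 f) -> layer k h w1 = Some (existT _ w2 g) ->
  exists (w3 : code) (g' : Hom (stack w) (stack w3)) (f' : Hom (stack w3) (stack w2)),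
  layer k h w = Some (existT _ w3 g') /\
  layer (n - arity h + coarity h) i w3 = Some (existT _ w2 f') /\
  g ∘ f = f' ∘ g').
{ clear. induction k as [|k IH]; intros n w w1 w2 f g Hk Hf Hg.
  - destruct (layer0_inv _ _ _ _ Hg) as [r ->].
    destruct (layer_left_inv _ _ _ _ _ _ Hf Hk) as (r0 & f0 & -> & Hf0).
    exists (gcod (get h) ++ r0), (lift (gsem (get h)) r0).
    rewrite layer0 in Hg. injection Hg as <- Hg.
    apply existT_inj in Hg. subst g.
    exists (whisker (gcod (get h)) f0). split; [apply layer0|].
    fold (arity h) in Hf0. pose proof (layer_left (gdom (get h)) _ _ _ _ _ Hf0) as K.
    fold (arity h) in K. replace (arity h + (n - arity h)) with n in K by (cbn in Hk; lia).
    rewrite Hf in K. injection K as K.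
    apply existT_inj in K. subst f.
    rewrite Nat.add_comm. split; [apply layer_left; exact Hf0|].
    apply lift_nat.
  - destruct n as [|n]; [lia|]. destruct w as [|x w]; [discriminate|].
    cbn in Hf. destruct (layer n i w) as [[u f0]|] eqn:Ef; [|discriminate].
    assert (Ew1 : x :: u = w1) by congruence. subst w1.
    apply (Some_existT_inj (x :: w)) in Hf. subst f.
    cbn in Hg. destruct (layer k h u) as [[u' g0]|] eqn:Eg; [|discriminate].
    assert (Ew2 : x :: u' = w2) by congruence. subst w2.
    apply (Some_existT_inj (x :: u)) in Hg. subst g.
    assert (Hk' : k + arity h <= n) by lia.
    destruct (IH n w u u' f0 g0 Hk' Ef Eg) as (w3 & g' & f' & H1 & H2 & H3).
    exists (x :: w3), (idm _ ⊗m g'), (idm _ ⊗m f').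
    replace (S n - arity h + coarity h) with (S (n - arity h + coarity h)) by lia.
    cbn [layer]. rewrite H1, H2. split; [reflexivity|]. split; [reflexivity|].
    etransitivity; [symmetry; apply tens1_comp|]. rewrite H3. apply tens1_comp. }
cbn in H. destruct (layer n i w) as [[w1 f]|] eqn:Ef; [|discriminate].
destruct (layer k h w1) as [[w2 g]|] eqn:Eg; [|discriminate].
destruct (key _ _ _ _ _ _ _ Hk Ef Eg) as (w3 & g' & f' & H1 & H2 & H3).
cbn. rewrite H1, H2. destruct (run d w2) as [[w4 e]|]; [|discriminate].
rewrite <- H, <- !compA, H3. reflexivity.
Qed.

Lemma run_cons (x : nat * nat) (d d' : diagram) :
  (forall w r, run d w = Some r -> run d' w = Some r) ->
  forall w r, run (x :: d) w = Some r -> run (x :: d') w = Some r.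
Proof.
intros H w r. destruct x as [n i]. cbn.
destruct (layer n i w) as [[w1 f]|]; [|discriminate].
destruct (run d w1) as [[w2 g]|] eqn:E; [|discriminate].
rewrite (H _ _ E). auto.
Qed.

End Calculus.

Arguments whisker {C ob} l {w w'} f.
Arguments lift {C ob u v} f w.
Arguments Gen {C ob} gdom gcod gsem.

(** * Rewriting diagrams

    The functions here see only the codes of the boundaries of the generators,
    so that they can be evaluated without unfolding any morphism. *)

Section Combinatorics.

Variable sg : list (list nat * list nat).
Definition ar (i : nat) : nat := length (fst (nth i sg ([], []))).
Definition coar (i : nat) : nat := length (snd (nth i sg ([], []))).

(** Layers on the left are moved to the front. Among generators with inputs
    this leads to the unique order in which the leftmost available one is always
    applied first. A generator without inputs fits anywhere between its
    neighbours; it is never moved forward, as the order would not be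
    canonical. *)
Fixpoint insert (x : nat * nat) (d : diagram) : diagram :=
  match d with
  | [] => [x]
  | y :: d' =>
      if (0 <? ar (snd y)) && (fst y + ar (snd y) <=? fst x)
      then y :: insert (fst x - ar (snd y) + coar (snd y), snd x) d'
      else x :: d
  end.

Definition normalize (d : diagram) : diagram := fold_right insert [] d.

Fixpoint prefix (u w : list nat) : option (list nat) :=
  match u, w with
  | [], _ => Some w
  | x :: u', y :: w' => if x =? y then prefix u' w' else None
  | _, _ => None
  end.

Fixpoint type_layer (n i : nat) (w : list nat) : option (list nat) :=
  match n, w with
  | 0, _ =>
      option_map (fun r => snd (nth i sg ([], [])) ++ r)
                 (prefix (fst (nth i sg ([], []))) w)
  | S n', x :: w' => option_map (cons x) (type_layer n' i w')
  | _, _ => None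
  end.

Fixpoint type_diagram (d : diagram) (w : list nat) : option (list nat) :=
  match d with
  | [] => Some w
  | (n, i) :: d' =>
      match type_layer n i w with Some w' => type_diagram d' w' | None => None end
  end.

Definition diagram_eqb (d d' : diagram) : bool :=
  if list_eq_dec (fun x y : nat * nat => ltac:(decide equality; apply Nat.eq_dec)) d d'
  then true else false.

(** [(u, l, r)] allows to replace [l] by [r] wherever the word is [u] and an
    arbitrary rest. *)
Definition rule : Type := (list nat * diagram * diagram)%type.

(** Rewriting at a proposed site, an initial part, a position and a final part.
    The proposal is checked, so that the search for sites needs no proof of
    correctness. *)
Definition apply_at (R : rule) (w : list nat) (d : diagram) (s : diagram * nat * diagram) :
    list diagram :=
  let '(u, l, r) := R in
  let '(pre, n, post) := s in
  match type_diagram pre w with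
  | Some v =>
      match prefix u (skipn n v), type_diagram (pre ++ shift n l ++ post) w with
      | Some _, Some _ =>
          if (n <=? length v) && diagram_eqb (normalize (pre ++ shift n l ++ post)) d
          then [normalize (pre ++ shift n r ++ post)] else []
      | _, _ => []
      end
  | None => []
  end.

(** The layers [y; x] in the order x, y, if they are disjoint. *)
Definition jump (x y : nat * nat) : option ((nat * nat) * (nat * nat)) :=
  if fst x + ar (snd x) <=? fst y
  then Some (x, (fst y - ar (snd x) + coar (snd x), snd y))
  else if fst y + coar (snd y) <=? fst x
  then Some ((fst x - coar (snd y) + ar (snd y), snd x), y)
  else None.

Fixpoint jumps (x : nat * nat) (d : diagram) : option ((nat * nat) * diagram) :=
  match d with
  | [] => Some (x, [])
  | y :: d' =>
      match jumps x d' with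
      | Some (x1, d1) =>
          match jump x1 y with
          | Some (x2, y2) => Some (x2, y2 :: d1)
          | None => None
          end
      | None => None
      end
  end.

(** Continues a partial occurrence [block] of a left hand side, of which [l] is
    still to be found. A layer of [rest] that does not match goes in front of
    the block if it can, otherwise it waits in [pend]. The fuel has to exceed the
    number of layers times the length of the left hand side. *)
Fixpoint grow (fuel o : nat) (l block pend rest pre : diagram) : list (diagram * nat * diagram) :=
  match fuel with
  | 0 => []
  | S fuel' =>
      match l with
      | [] => [(pre, match block with [] => 0 | (k, _) :: _ => k - o end, pend ++ rest)]
      | (p, h) :: l' =>
          match rest with
          | [] => []
          | x :: rest' =>
              match jumps x pend with
              | Some ((k, i), pend') =>
                  if (i =? h) && (match block with [] => true | (b, _) :: _ => k + o =? b + p end)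
                  then grow fuel' o l' (block ++ [(k, i)]) [] (pend' ++ rest') pre
                  else
                    match jumps (k, i) block with
                    | Some (x', block') => grow fuel' o l block' pend' rest' (pre ++ [x'])
                    | None => grow fuel' o l block (pend ++ [x]) rest' pre
                    end
              | None => grow fuel' o l block (pend ++ [x]) rest' pre
              end
          end
      end
  end.

Fixpoint cuts (pre d : diagram) : list (diagram * diagram) :=
  (pre, d) :: match d with [] => [] | x :: d' => cuts (pre ++ [x]) d' end.

Fixpoint push (y : nat * nat) (G : diagram) : option (diagram * (nat * nat)) :=
  match G with
  | [] => Some ([], y)
  | g :: G' =>
      match jump g y with
      | Some (g1, y1) =>
          match push y1 G' with
          | Some (G1, y2) => Some (g1 :: G1, y2)
          | None => None
          end
      | None => None
      end
  end.

(** Moves behind [G] all the layers in front of it on which it does not depend;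
    they may belong to the occurrence that starts there. *)
Fixpoint defer (rpre G rest : diagram) : diagram * diagram :=
  match rpre with
  | [] => (G, rest)
  | y :: rpre' =>
      match push y G with
      | Some (G', y') => defer rpre' G' (y' :: rest)
      | None => defer rpre' (y :: G) rest
      end
  end.

(** The empty left hand side, of rules that introduce a cancelling pair of
    braidings, occurs at every position. *)
Definition sites (w : list nat) (l d : diagram) : list (diagram * nat * diagram) :=
  flat_map (fun pd : diagram * diagram =>
    let (pre, post) := pd in
    match l with
    | [] =>
        match type_diagram pre w with
        | Some v => map (fun n => (pre, n, post)) (seq 0 (S (length v)))
        | None => []
        end
    | (o, h) :: l' =>
        match post with
        | x :: post' =>
            if snd x =? h then
              let (G, rest) := defer (rev pre) [x] post' in
              match rev G with
              | (k, i) :: G' =>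
                  if o <=? k then grow 200 o l' [(k, i)] [] rest (rev G') else []
              | [] => []
              end
            else []
        | [] => []
        end
    end) (cuts [] d).

Definition rewrite1 (w : list nat) (R : rule) (d : diagram) : list diagram :=
  flat_map (apply_at R w d) (sites w (snd (fst R)) d).

Fixpoint dedup (l : list diagram) : list diagram :=
  match l with
  | [] => []
  | d :: l' => if existsb (diagram_eqb d) l' then dedup l' else d :: dedup l'
  end.

Definition rewrites (w : list nat) (Rs : list rule) (d : diagram) : list diagram :=
  fold_left (fun ds R => dedup (flat_map (rewrite1 w R) ds)) Rs [normalize d].

Definition derivable (w : list nat) (Rs : list rule) (d d' : diagram) : bool :=
  existsb (diagram_eqb (normalize d')) (rewrites w Rs d).

Inductive term : Type :=
| TGen (i : nat)
| TId (w : list nat)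
| TComp (g f : term)
| TTens (f g : term).

Fixpoint flatten (t : term) : option (list nat * list nat * diagram) :=
  match t with
  | TGen i => Some (fst (nth i sg ([], [])), snd (nth i sg ([], [])), [(0, i)])
  | TId w => Some (w, w, [])
  | TComp g f =>
      match flatten g, flatten f with
      | Some (_, v, d), Some (u, _, d') => Some (u, v, d' ++ d)
      | _, _ => None
      end
  | TTens f g =>
      match flatten f, flatten g with
      | Some (u, v, d), Some (u', v', d') =>
          Some (u ++ u', v ++ v', shift (length u) d' ++ d)
      | _, _ => None
      end
  end.

Definition provable (rules : list (term * term)) (t t' : term) : bool :=
  let to_rule r :=
    match flatten (fst r), flatten (snd r) with
    | Some (u, _, l), Some (_, _, l') => (u, l, l')
    | _, _ => ([], [], [])
    end in
  match flatten t, flatten t' with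
  (* the word [u] on the empty rest, in the form in which [lift] has it *)
  | Some (u, _, d), Some (_, _, d') => derivable (u ++ []) (map to_rule rules) d d'
  | _, _ => false
  end.

End Combinatorics.

(** * Soundness of rewriting *)

Section Soundness.

Variables (C : monoidal_category) (ob : nat -> C) (gens : list (gen C ob)).

Definition boundaries : list (list nat * list nat) :=
  map (fun g => (gdom C ob g, gcod C ob g)) gens.

Variable sg : list (list nat * list nat).
Hypothesis sgE : sg = boundaries.

Local Notation run := (run C ob gens).
Local Notation layer := (layer C ob gens).
Local Notation get := (get C ob gens).

Lemma nth_sg (i : nat) : nth i sg ([], []) = (gdom C ob (get i), gcod C ob (get i)).
Proof.
rewrite sgE. unfold boundaries.
exact (map_nth (fun g => (gdom C ob g, gcod C ob g)) gens (Gen [] [] (idm (@unit_ob C))) i).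
Qed.

Lemma ar_arity (i : nat) : ar sg i = arity C ob gens i.
Proof. unfold ar, arity. rewrite nth_sg. reflexivity. Qed.

Lemma coar_coarity (i : nat) : coar sg i = coarity C ob gens i.
Proof. unfold coar, coarity. rewrite nth_sg. reflexivity. Qed.

Lemma insert_sound (x : nat * nat) (d : diagram) (w : list nat) r :
  run (x :: d) w = Some r -> run (insert sg x d) w = Some r.
Proof.
revert x w r. induction d as [|[k h] d IH]; intros [n i] w r H; [exact H|].
cbn [insert fst snd]. destruct (0 <? ar sg h); [|exact H].
destruct (Nat.leb_spec (k + ar sg h) n) as [K|K]; [|exact H]. cbn [andb].
rewrite ar_arity in *. rewrite coar_coarity.
apply exchange in H; [|exact K].
revert H. apply run_cons. intros w' r'. apply IH.
Qed.

Lemma normalize_sound (d : diagram) (w : list nat) r :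
  run d w = Some r -> run (normalize sg d) w = Some r.
Proof.
revert w r. induction d as [|x d IH]; intros w r H; [exact H|].
apply insert_sound. revert H. apply run_cons, IH.
Qed.

Lemma prefix_sound (u w r : list nat) : prefix u w = Some r -> w = u ++ r.
Proof.
revert w. induction u as [|x u IH]; intros w H; cbn in H.
- injection H as ->. reflexivity.
- destruct w as [|y w]; [discriminate|].
  destruct (Nat.eqb_spec x y) as [->|]; [|discriminate].
  rewrite (IH _ H). reflexivity.
Qed.

Lemma type_layer_sound (n i : nat) (w w' : list nat) :
  type_layer sg n i w = Some w' -> exists f, layer n i w = Some (existT _ w' f).
Proof.
revert w w'. induction n as [|n IH]; intros w w' H; cbn [type_layer] in H.
- rewrite nth_sg in H. cbn [fst snd] in H.
  destruct (prefix _ w) as [r|] eqn:E; [|discriminate].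
  apply prefix_sound in E. injection H as <-. subst w.
  eexists. apply layer0.
- destruct w as [|x w]; [discriminate|].
  destruct (type_layer sg n i w) as [w1|] eqn:E; [|discriminate].
  injection H as <-. destruct (IH _ _ E) as [f Hf].
  cbn. rewrite Hf. eexists. reflexivity.
Qed.

Lemma type_diagramram_sound (d : diagram) (w w' : list nat) :
  type_diagram sg d w = Some w' -> exists f, run d w = Some (existT _ w' f).
Proof.
revert w. induction d as [|[n i] d IH]; intros w H.
- injection H as ->. eexists. reflexivity.
- cbn in H. destruct (type_layer sg n i w) as [w1|] eqn:E; [|discriminate].
  destruct (type_layer_sound _ _ _ _ E) as [f Hf].
  destruct (IH _ H) as [g Hg].
  cbn. rewrite Hf, Hg. eexists. reflexivity.
Qed.

Lemma diagram_eqb_eq (d d' : diagram) : diagram_eqb d d' = true -> d = d'.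
Proof. unfold diagram_eqb. destruct list_eq_dec; [auto | discriminate]. Qed.

Definition valid (R : rule) : Prop :=
  let '(u, l, r) := R in
  forall x, exists v f, run l (u ++ x) = Some (existT _ v f) /\
                        run r (u ++ x) = Some (existT _ v f).

Lemma valid_shift (u : list nat) (l r : diagram) (n : nat) (v x : list nat) y :
  valid (u, l, r) -> prefix u (skipn n v) = Some x -> n <= length v ->
  run (shift n l) v = Some y -> run (shift n r) v = Some y.
Proof.
intros HR Hx Hn. apply prefix_sound in Hx.
destruct (HR x) as (z & f & Hl & Hr).
pose proof (run_left C ob gens (firstn n v) _ _ _ _ Hl) as Kl.
pose proof (run_left C ob gens (firstn n v) _ _ _ _ Hr) as Kr.
rewrite <- Kr in Kl. clear Kr. rewrite length_firstn, Nat.min_l in Kl by exact Hn.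
rewrite <- Hx, firstn_skipn in Kl. rewrite Kl. auto.
Qed.

Lemma apply_at_sound (R : rule) (w : list nat) (d d' : diagram) s y :
  valid R -> In d' (apply_at sg R w d s) -> run d w = Some y -> run d' w = Some y.
Proof.
destruct R as [[u l] r], s as [[pre n] post]. intros HR H Hd. unfold apply_at in H.
destruct (type_diagram sg pre w) as [v|] eqn:Ev; [|destruct H].
destruct (prefix u (skipn n v)) as [x|] eqn:Ex; [|destruct H].
destruct (type_diagram sg (pre ++ _) w) as [v'|] eqn:Ev'; [|destruct H].
destruct (_ && _) eqn:Eb; [|destruct H].
apply andb_true_iff in Eb as [Hn Eb]. apply Nat.leb_le in Hn. apply diagram_eqb_eq in Eb.
destruct H as [<-|[]].
destruct (type_diagramram_sound _ _ _ Ev') as [f Hf].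
pose proof (normalize_sound _ _ _ Hf) as K. rewrite Eb, Hd in K. injection K as ->.
apply normalize_sound. rewrite <- Hf. rewrite run_app in Hf |- *.
destruct (type_diagramram_sound _ _ _ Ev) as [g Hg]. rewrite Hg in *.
rewrite run_app in Hf |- *.
destruct (run (shift n l) v) as [z|] eqn:El; [|discriminate].
rewrite (valid_shift u l r n v x z HR Ex Hn El), run_app, Hg, run_app, El.
reflexivity.
Qed.

Lemma dedup_in (d : diagram) (l : list diagram) : In d (dedup l) -> In d l.
Proof.
induction l as [|x l IH]; [auto|]. cbn. destruct existsb; cbn; tauto.
Qed.

Lemma rewrites_sound (w : list nat) (Rs : list rule) (d d' : diagram) y :
  Forall valid Rs -> In d' (rewrites sg w Rs d) -> run d w = Some y -> run d' w = Some y.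
Proof.
intros HR Hin Hd. unfold rewrites in Hin.
assert (H0 : forall x, In x [normalize sg d] -> run x w = Some y).
{ intros x [<-|[]]. apply normalize_sound, Hd. }
revert H0 Hin. generalize [normalize sg d].
induction HR as [|R Rs HR _ IH]; cbn [fold_left]; intros ds H0 Hin; [auto|].
revert Hin. apply IH. intros x Hx.
apply dedup_in, in_flat_map in Hx as (z & Hz & Hx).
apply in_flat_map in Hx as (s & _ & Hx).
exact (apply_at_sound R w z x s y HR Hx (H0 z Hz)).
Qed.

Lemma derivable_sound (w : list nat) (Rs : list rule) (d d' : diagram) y y' :
  Forall valid Rs -> derivable sg w Rs d d' = true ->
  run d w = Some y -> run d' w = Some y' -> y = y'.
Proof.
intros HR H Hd Hd'. unfold derivable in H. apply existsb_exists in H as (x & Hx & Ex).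
apply diagram_eqb_eq in Ex. subst x. apply normalize_sound in Hd'.
rewrite (rewrites_sound _ _ _ _ _ HR Hx Hd) in Hd'. injection Hd'. auto.
Qed.

Local Notation whom' u v := (@whom C (map ob u) (map ob v)).

Record arrow := Arrow { source : list nat; target : list nat; body : whom' source target }.

Definition compose (g f : arrow) : option arrow :=
  match list_eq_dec Nat.eq_dec (target f) (source g) with
  | left e =>
      Some (Arrow (source f) (target g)
        (match e in _ = x return whom' x (target g) -> whom' (source f) (target g) with
         | eq_refl => fun h => h ∙ body f
         end (body g)))
  | right _ => None
  end.

Fixpoint denote (t : term) : option arrow :=
  match t with
  | TGen i => Some (Arrow _ _ (gsem C ob (get i)))
  | TId w => Some (Arrow w w (idm (obj (map ob w))))
  | TComp g f =>
      match denote g, denote f with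
      | Some b, Some a => compose b a
      | _, _ => None
      end
  | TTens f g =>
      match denote f, denote g with
      | Some a, Some b => Some (Arrow _ _ (code_tens C ob _ _ _ _ (body a) (body b)))
      | _, _ => None
      end
  end.

(** The diagram of a term acts like the morphism that the term denotes on the
    top of every stack; for a product this is [lift_tens]. *)
Lemma flatten_sound (t : term) (a : arrow) :
  denote t = Some a ->
  exists d, flatten sg t = Some (source a, target a, d) /\
  forall w, run d (source a ++ w) = Some (existT _ (target a ++ w) (lift (body a) w)).
Proof.
revert a. induction t as [i|u|g IHg f IHf|f IHf g IHg]; intros a H; cbn in H.
- injection H as <-. exists [(0, i)]. cbn [flatten]. rewrite nth_sg. split; [reflexivity|].
  intros w. cbn [run source target body]. rewrite layer0, comp1m. reflexivity.
- injection H as <-. exists []. split; [reflexivity|].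
  intros w. cbn. rewrite lift1. reflexivity.
- destruct (denote g) as [b|]; [|discriminate].
  destruct (denote f) as [c|]; [|discriminate].
  destruct (IHg _ eq_refl) as (d & E & K), (IHf _ eq_refl) as (d' & E' & K').
  clear IHg IHf. destruct b as [x v g'], c as [u x' f']. unfold compose in H. cbn [source target body] in *.
  destruct (list_eq_dec Nat.eq_dec x' x) as [e|]; [|discriminate].
  destruct e. injection H as <-. exists (d' ++ d). cbn [flatten]. rewrite E, E'. split; [reflexivity|].
  intros w. cbn. rewrite run_app, K', K, lift_comp. reflexivity.
- destruct (denote f) as [b|]; [|discriminate].
  destruct (denote g) as [c|]; [|discriminate].
  destruct (IHf _ eq_refl) as (d & E & K), (IHg _ eq_refl) as (d' & E' & K').
  clear IHg IHf. destruct b as [u v f'], c as [u' v' g']. cbn in *.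
  injection H as <-. exists (shift (length u) d' ++ d). rewrite E, E'.
  split; [reflexivity|]. intros w. cbn.
  rewrite (lift_tens C ob u v u' v' w f' g' (eq_sym (app_assoc _ _ _)) (app_assoc _ _ _)).
  assert (H : run (shift (length u) d' ++ d) (u ++ u' ++ w) =
    Some (existT _ (v ++ v' ++ w) (lift f' (v' ++ w) ∘ whisker u (lift g' w)))).
  { rewrite run_app, (run_left C ob gens u d' _ _ _ (K' w)), K. reflexivity. }
  revert H. generalize (lift f' (v' ++ w) ∘ whisker u (lift g' w)).
  generalize (eq_sym (app_assoc u u' w)), (app_assoc v v' w).
  intros e e'. destruct e', e. intros h ->. rewrite !stack_cast_id, comp1m, compm1. reflexivity.
Qed.

Definition holds (r : term * term) : Prop :=
  exists a, denote (fst r) = Some a /\ denote (snd r) = Some a.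

Theorem provable_sound (rules : list (term * term)) (t t' : term) (u v : list nat)
    (f f' : whom' u v) :
  provable sg rules t t' = true ->
  Forall holds rules ->
  denote t = Some (Arrow u v f) -> denote t' = Some (Arrow u v f') -> f = f'.
Proof.
intros H HR E E'.
destruct (flatten_sound _ _ E) as (d & Ed & Kd), (flatten_sound _ _ E') as (d' & Ed' & Kd').
unfold provable in H. rewrite Ed, Ed' in H. cbn [source target body] in *.
apply (lift_inj C ob), (existT_inj C ob). refine (derivable_sound _ _ _ _ _ _ _ H (Kd []) (Kd' [])).
apply Forall_map. revert HR. apply Forall_impl. intros [l r] (a & Hl & Hr).
cbn [fst snd] in *.
destruct (flatten_sound _ _ Hl) as (x & -> & Kx), (flatten_sound _ _ Hr) as (x' & -> & Kx').
intros w. exists (target a ++ w), (lift (body a) w). split; [apply Kx | apply Kx'].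
Qed.

Lemma holds_intro (t t' : term) (u v : list nat) (f f' : whom' u v) :
  f = f' -> denote t = Some (Arrow u v f) -> denote t' = Some (Arrow u v f') ->
  holds (t, t').
Proof. intros <- H H'. exists (Arrow u v f). split; [exact H | exact H']. Qed.

End Soundness.

(** * The diagram tactic *)

Definition idw {C : monoidal_category} (w : list C) : whom w w := idm (obj w).

Section Braids.

Variable C : braided_monoidal_category.

(** An object crossing a word, as a composite of elementary crossings: from left
    to right, from right to left, and the same with inverse crossings. *)
Fixpoint braidL (X : C) (u : list C) : whom (X :: u) (u ++ [X]) :=
  match u with
  | [] => one X
  | Y :: u' => (one Y ⊠ braidL X u') ∙ (wbraid X Y ⊠ idw u')
  end.

Fixpoint braidR (u : list C) (X : C) : whom (u ++ [X]) (X :: u) :=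
  match u with
  | [] => one X
  | Y :: u' => (wbraid Y X ⊠ idw u') ∙ (one Y ⊠ braidR u' X)
  end.

Fixpoint braidVL (X : C) (u : list C) : whom (X :: u) (u ++ [X]) :=
  match u with
  | [] => one X
  | Y :: u' => (one Y ⊠ braidVL X u') ∙ (wbraidV Y X ⊠ idw u')
  end.

Fixpoint braidVR (u : list C) (X : C) : whom (u ++ [X]) (X :: u) :=
  match u with
  | [] => one X
  | Y :: u' => (wbraidV X Y ⊠ idw u') ∙ (one Y ⊠ braidVR u' X)
  end.

End Braids.

Ltac position x l :=
  lazymatch l with
  | ?y :: ?l' =>
      match constr:(x) with
      | y => constr:(0)
      | _ => let n := position x l' in constr:(S n)
      end
  end.

Ltac insert_new x l :=
  match l with
  | context [cons x _] => l
  | _ => let l' := eval cbn [app] in (l ++ [x]) in l'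
  end.

Ltac insert_word w l :=
  lazymatch w with
  | nil => l
  | ?x :: ?w' => let l' := insert_new x l in insert_word w' l'
  end.

Ltac word_code obs w :=
  lazymatch w with
  | nil => constr:(@nil nat)
  | ?x :: ?w' => let n := position x obs in let v := word_code obs w' in constr:(n :: v)
  end.

Ltac word_of w := eval cbn [app] in w.

(* Morphisms have different types, so they are collected in nested pairs. *)
Ltac gen_position x l :=
  lazymatch l with
  | (?y, ?l') =>
      match constr:(x) with
      | y => constr:(0)
      | _ => let n := gen_position x l' in constr:(S n)
      end
  end.

Ltac gen_insert x l :=
  lazymatch l with
  | tt => constr:((x, tt))
  | (?y, ?l') =>
      match constr:(x) with
      | y => l
      | _ => let m := gen_insert x l' in constr:((y, m))
      end
  end.

Ltac gather_gens e l :=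
  lazymatch e with
  | wcomp ?g ?f => let l1 := gather_gens g l in gather_gens f l1
  | wtens ?g ?f => let l1 := gather_gens g l in gather_gens f l1
  | one _ => l
  | idw _ => l
  | _ => gen_insert e l
  end.

Ltac gather_obs e l :=
  lazymatch e with
  | wcomp ?g ?f => let l1 := gather_obs g l in gather_obs f l1
  | wtens ?g ?f => let l1 := gather_obs g l in gather_obs f l1
  | one ?X => insert_new X l
  | idw ?w => let w' := word_of w in insert_word w' l
  | _ =>
      lazymatch type of e with
      | whom ?u ?v =>
          let u' := word_of u in
          let v' := word_of v in
          let l1 := insert_word u' l in insert_word v' l1
      end
  end.

Ltac quote obs gs e :=
  lazymatch e with
  | wcomp ?g ?f =>
      let a := quote obs gs g in let b := quote obs gs f in constr:(TComp a b)
  | wtens ?g ?f =>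
      let a := quote obs gs g in let b := quote obs gs f in constr:(TTens a b)
  | one ?X => let n := position X obs in constr:(TId [n])
  | idw ?w => let w' := word_of w in let n := word_code obs w' in constr:(TId n)
  | _ => let n := gen_position e gs in constr:(TGen n)
  end.

Ltac gen_list C ob obs gs :=
  lazymatch gs with
  | tt => constr:(@nil (gen C ob))
  | (?g, ?gs') =>
      lazymatch type of g with
      | whom ?u ?v =>
          let u' := word_of u in
          let v' := word_of v in
          let a := word_code obs u' in
          let b := word_code obs v' in
          let r := gen_list C ob obs gs' in
          constr:(@Gen C ob a b g :: r)
      end
  end.

Ltac sig_list obs gs :=
  lazymatch gs with
  | tt => constr:(@nil (list nat * list nat))
  | (?g, ?gs') =>
      lazymatch type of g with
      | whom ?u ?v =>
          let u' := word_of u in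
          let v' := word_of v in
          let a := word_code obs u' in
          let b := word_code obs v' in
          let r := sig_list obs gs' in
          constr:((a, b) :: r)
      end
  end.

(* Naturality is stated for a crossing of arbitrary words; as a rule it has to be
   spelled out in elementary crossings. *)
Ltac rule_type H :=
  let T := type of H in eval cbn [braidL braidR braidVL braidVR app] in T.

Ltac gather_gens_rules rs l :=
  lazymatch rs with
  | tt => l
  | (?rs', ?H) =>
      let T := rule_type H in lazymatch T with
      | ?a = ?b =>
          let l1 := gather_gens a l in
          let l2 := gather_gens b l1 in gather_gens_rules rs' l2
      end
  end.

Ltac gather_obs_rules rs l :=
  lazymatch rs with
  | tt => l
  | (?rs', ?H) =>
      let T := rule_type H in lazymatch T with
      | ?a = ?b =>
          let l1 := gather_obs a l in
          let l2 := gather_obs b l1 in gather_obs_rules rs' l2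
      end
  end.

Ltac quote_rules obs gs rs acc :=
  lazymatch rs with
  | tt => acc
  | (?rs', ?H) =>
      let T := rule_type H in lazymatch T with
      | ?a = ?b =>
          let x := quote obs gs a in
          let y := quote obs gs b in
          quote_rules obs gs rs' constr:((x, y) :: acc)
      end
  end.

Ltac prove_rules C ob gl obs gs rs rl acc :=
  lazymatch rs with
  | tt => acc
  | (?rs', ?H) =>
      let T := rule_type H in lazymatch T with
      | @eq (whom ?u ?v) ?a ?b =>
          let x := quote obs gs a in
          let y := quote obs gs b in
          let u' := word_of u in
          let v' := word_of v in
          let cu := word_code obs u' in
          let cv := word_code obs v' in
          prove_rules C ob gl obs gs rs' constr:((x, y) :: rl)
            constr:(@Forall_cons _ (holds C ob gl) (x, y) rl
              (holds_intro C ob gl x y cu cv a b H eq_refl eq_refl) acc)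
      end
  end.

Ltac rule_list rs :=
  lazymatch rs with
  | (?a, ?H) => let r := rule_list a in constr:((r, H))
  | tt => tt
  | ?H => constr:((tt, H))
  end.

Ltac solve_diagram rs0 :=
  let rs := rule_list rs0 in
  lazymatch goal with
  | |- @eq (@whom ?C ?u ?v) ?f ?g =>
    let o1 := gather_obs f constr:(@nil (Ob (mon_cat C))) in
    let o2 := gather_obs g o1 in
    let obs := gather_obs_rules rs o2 in
    let g1 := gather_gens f tt in
    let g2 := gather_gens g g1 in
    let gs := gather_gens_rules rs g2 in
    let ob := constr:(fun n : nat => nth n obs (@unit_ob C)) in
    let gl := gen_list C ob obs gs in
    let sg := sig_list obs gs in
    let t := quote obs gs f in
    let t' := quote obs gs g in
    let rl := quote_rules obs gs rs constr:(@nil (term * term)) in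
    let u' := word_of u in
    let v' := word_of v in
    let cu := word_code obs u' in
    let cv := word_code obs v' in
    let pr := prove_rules C ob gl obs gs rs constr:(@nil (term * term))
      constr:(@Forall_nil _ (holds C ob gl)) in
    refine (provable_sound C ob gl sg eq_refl rl t t' cu cv f g _ pr eq_refl eq_refl);
    vm_compute; reflexivity
  end.

Tactic Notation "diag" constr(rs) := solve_diagram rs.
Tactic Notation "diag" := solve_diagram tt.

(** * Naturality of the braiding *)

(** The hexagon at two units says that the left hand side is idempotent up to
    the unit isomorphisms, and it is invertible. *)
Lemma lunit_braid (C : braided_monoidal_category) (X : C) : lunit X ∘ braid X unit_ob = runit X.
Proof.
set (b := lunit X ∘ braid X unit_ob).
assert (H : b ∘ (b ⊗m idm unit_ob) = b ∘ (runit X ⊗m idm unit_ob)).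
{ rewrite <- triangle, compA. unfold b at 3.
  rewrite <- (compA (lunit X)), braid_nat, compA, <- lunit_tens, compA.
  rewrite <- (lunit_nat (lunit X)).
  rewrite <- (compA _ (assoc _ _ _)), <- (compA _ (_ ∘ _)), hexagon1.
  unfold b at 2. rewrite tens_comp1, <- lunit_tens, !compA, <- lunit_nat.
  unfold b. rewrite tens1_comp, !compA. reflexivity. }
assert (K : b ∘ (braidV X unit_ob ∘ lunitV X) = idm _).
{ unfold b. apply cancel_comp; [apply lunitVK | apply braidVK]. }
assert (K' : (braidV X unit_ob ∘ lunitV X) ∘ b = idm _).
{ unfold b. apply cancel_comp; [apply braidK | apply lunitK]. }
apply (f_equal (fun h => (braidV X unit_ob ∘ lunitV X) ∘ h)) in H.
rewrite !(compA (_ ∘ _) b), K', !comp1m in H.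
apply (conj_inj _ _ _ _ _ b (runit X) (idm _) (idm _) (runit _) (runitV _));
  [apply comp1m | apply runitVK |].
rewrite !comp1m, <- !runit_nat, H. reflexivity.
Qed.

Section BraidNaturality.

Variable C : braided_monoidal_category.
Local Notation braidL := (@braidL C).
Local Notation braidR := (@braidR C).

Definition word_braid (u v : list C) : whom (u ++ v) (v ++ u) :=
  word_join v u ∘ braid (obj u) (obj v) ∘ word_split u v.

Lemma word_braid_nat (u u' v v' : list C) (f : whom u u') (g : whom v v') :
  word_braid u' v' ∙ (f ⊠ g) = (g ⊠ f) ∙ word_braid u v.
Proof.
unfold word_braid, wcomp, wtens.
rewrite !compA, <- (compA _ (word_split u' v')), word_joinK, compm1.
rewrite <- (compA _ (word_split v u)), !compA, <- (compA _ (word_split v u)), word_joinK, compm1.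
rewrite <- (compA _ (braid _ _)), braid_nat, !compA. reflexivity.
Qed.

Lemma runit_braid (X : C) : runit X ∘ braid unit_ob X = lunit X.
Proof. exact (@lunit_braid (reversed C) X). Qed.

Lemma word_braid_nil_r (X : C) : word_braid [X] [] = one X.
Proof.
unfold word_braid. cbn. rewrite lunit_braid. apply runitVK.
Qed.

Lemma word_braid_nil_l (X : C) : word_braid [] [X] = one X.
Proof.
unfold word_braid. cbn. rewrite runit_braid. apply lunitVK.
Qed.

(** Iterating the hexagon. *)
Lemma braidL_word (X : C) (u : list C) : braidL X u = word_braid [X] u.
Proof.
induction u as [|Y [|Z u] IH].
- symmetry. apply word_braid_nil_r.
- transitivity (wbraid X Y).
  + change ((one Y ⊠ one X) ∙ (wbraid X Y ⊠ idw []) = wbraid X Y). diag.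
  + unfold word_braid. cbn. rewrite comp1m, compm1. reflexivity.
- change (braidL X (Y :: Z :: u)) with ((one Y ⊠ braidL X (Z :: u)) ∙ (wbraid X Y ⊠ idw (Z :: u))).
  rewrite IH. unfold word_braid, wcomp, wtens, idw, one, wbraid.
  set (U := obj (Z :: u)).
  change (word_join [Y] ((Z :: u) ++ [X])) with (idm (Y ⊗ obj ((Z :: u) ++ [X]))).
  change (word_split [Y] (X :: Z :: u)) with (idm (Y ⊗ (X ⊗ U))).
  change (word_join [X] (Z :: u)) with (idm (X ⊗ U)).
  change (word_split [X] (Z :: u)) with (idm (X ⊗ U)).
  change (word_split [X] (Y :: Z :: u)) with (idm (X ⊗ (Y ⊗ U))).
  change (word_join (Y :: Z :: u) [X]) with
    ((idm Y ⊗m word_join (Z :: u) [X]) ∘ assoc Y U X).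
  change (word_join [Y; X] (Z :: u)) with ((idm Y ⊗m idm (X ⊗ U)) ∘ assoc Y X U).
  change (word_split [X; Y] (Z :: u)) with (assocV X Y U ∘ (idm X ⊗m idm (Y ⊗ U))).
  rewrite !tensm1, !compm1, !comp1m. change (obj [X]) with X. change (obj (Y :: Z :: u)) with (Y ⊗ U).
  rewrite tens1_comp.
  pose proof (hexagon1 X Y U) as H.
  apply (f_equal (fun h => (idm Y ⊗m word_join (Z :: u) [X]) ∘ h ∘ assocV X Y U)) in H.
  rewrite !compA in H. rewrite <- (compA _ (assoc X Y U)), assocVK, compm1 in H.
  symmetry. etransitivity; [exact H|]. rewrite !compA. reflexivity.
Qed.

Lemma braidR_word (X : C) (u : list C) : braidR u X = word_braid u [X].
Proof.
induction u as [|Y [|Z u] IH].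
- symmetry. apply word_braid_nil_l.
- transitivity (wbraid Y X).
  + change ((wbraid Y X ⊠ idw []) ∙ (one Y ⊠ one X) = wbraid Y X). diag.
  + unfold word_braid. cbn. rewrite comp1m, compm1. reflexivity.
- change (braidR (Y :: Z :: u) X) with
    ((wbraid Y X ⊠ idw (Z :: u)) ∙ (one Y ⊠ braidR (Z :: u) X)).
  rewrite IH. unfold word_braid, wcomp, wtens, idw, one, wbraid.
  set (U := obj (Z :: u)).
  change (word_join [X] (Z :: u)) with (idm (X ⊗ U)).
  change (word_join [X] (Y :: Z :: u)) with (idm (X ⊗ (Y ⊗ U))).
  change (word_join [Y] (X :: Z :: u)) with (idm (Y ⊗ (X ⊗ U))).
  change (word_split [Y] ((Z :: u) ++ [X])) with (idm (Y ⊗ obj ((Z :: u) ++ [X]))).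
  change (word_split (Y :: Z :: u) [X]) with
    (assocV Y U X ∘ (idm Y ⊗m word_split (Z :: u) [X])).
  change (word_join [X; Y] (Z :: u)) with ((idm X ⊗m idm (Y ⊗ U)) ∘ assoc X Y U).
  change (word_split [Y; X] (Z :: u)) with (assocV Y X U ∘ (idm Y ⊗m idm (X ⊗ U))).
  rewrite !tensm1, !compm1, !comp1m. change (obj [X]) with X. change (obj (Y :: Z :: u)) with (Y ⊗ U).
  rewrite tens1_comp.
  pose proof (hexagon2 Y U X) as H.
  apply (f_equal (fun h => assoc X Y U ∘ h ∘ (idm Y ⊗m word_split (Z :: u) [X]))) in H.
  rewrite !compA in H. rewrite assocVK, comp1m in H.
  symmetry. etransitivity; [|etransitivity; [exact H|]]; rewrite !compA; reflexivity.
Qed.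

Lemma braidL_nat (X : C) (u v : list C) (f : whom u v) :
  braidL X v ∙ (one X ⊠ f) = (f ⊠ one X) ∙ braidL X u.
Proof. rewrite !braidL_word. exact (word_braid_nat _ _ _ _ (one X) f). Qed.

Lemma braidR_nat (X : C) (u v : list C) (f : whom u v) :
  braidR v X ∙ (f ⊠ one X) = (one X ⊠ f) ∙ braidR u X.
Proof. rewrite !braidR_word. exact (word_braid_nat _ _ _ _ f (one X)). Qed.

Lemma wbraidK (X Y : C) : wbraidV X Y ∙ wbraid X Y = one X ⊠ one Y.
Proof.
etransitivity; [exact (braidK X Y)|]. unfold wtens, one. cbn.
rewrite tensm1, comp1m. symmetry. apply comp1m.
Qed.

Lemma wbraidVK (X Y : C) : wbraid X Y ∙ wbraidV X Y = one Y ⊠ one X.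
Proof.
etransitivity; [exact (braidVK X Y)|]. unfold wtens, one. cbn.
rewrite tensm1, comp1m. symmetry. apply comp1m.
Qed.

End BraidNaturality.

Section Inverse.

Variable C : braided_monoidal_category.

Lemma braidVL_nat (X : C) (u v : list C) (f : whom u v) :
  @braidVL C X v ∙ (one X ⊠ f) = (f ⊠ one X) ∙ @braidVL C X u.
Proof. exact (braidL_nat (inverse_braided C) X u v f). Qed.

Lemma braidVR_nat (X : C) (u v : list C) (f : whom u v) :
  @braidVR C v X ∙ (f ⊠ one X) = (one X ⊠ f) ∙ @braidVR C u X.
Proof. exact (braidR_nat (inverse_braided C) X u v f). Qed.

End Inverse.

(** * Coequalizers and cancellation for words *)

Set Implicit Arguments.
Unset Strict Implicit.
Unset Printing Implicit Defensive.

Arguments braidL {C} X u.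
Arguments braidR {C} u X.
Arguments braidVL {C} X u.
Arguments braidVR {C} u X.
Arguments braidL_nat {C} X {u v} f.
Arguments braidR_nat {C} X {u v} f.
Arguments braidVL_nat {C} X {u v} f.
Arguments braidVR_nat {C} X {u v} f.
Arguments wbraidK {C} X Y.
Arguments wbraidVK {C} X Y.

Section Words.

Variable C : monoidal_category.

Lemma wtens_comp (u u' u'' v v' v'' : list C) (f' : whom u' u'') (f : whom u u')
    (g' : whom v' v'') (g : whom v v') :
  (f' ∙ f) ⊠ (g' ∙ g) = (f' ⊠ g') ∙ (f ⊠ g).
Proof.
unfold wtens, wcomp. rewrite tensm_comp, !compA.
rewrite <- (compA _ (word_split u' v')), word_joinK, compm1. reflexivity.
Qed.

Lemma one_tens_comp (Z : C) (u u' u'' : list C) (f' : whom u' u'') (f : whom u u') :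
  one Z ⊠ (f' ∙ f) = (one Z ⊠ f') ∙ (one Z ⊠ f).
Proof. rewrite <- wtens_comp. do 2 f_equal. symmetry. apply comp1m. Qed.

Lemma tens_one_comp (Z : C) (u u' u'' : list C) (f' : whom u' u'') (f : whom u u') :
  (f' ∙ f) ⊠ one Z = (f' ⊠ one Z) ∙ (f ⊠ one Z).
Proof. rewrite <- wtens_comp. f_equal. symmetry. apply comp1m. Qed.

Lemma wcompA (u v w x : list C) (h : whom w x) (g : whom v w) (f : whom u v) :
  h ∙ (g ∙ f) = h ∙ g ∙ f.
Proof. apply compA. Qed.

(** A word as a word with one letter: hypotheses about morphisms with a single
    domain object extend along it to words. *)
Definition pack (w : list C) : whom w [obj w] := idm (obj w).
Definition unpack (w : list C) : whom [obj w] w := idm (obj w).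

Lemma unpack_inj (w v : list C) (g g' : whom w v) : g ∙ unpack w = g' ∙ unpack w -> g = g'.
Proof. unfold wcomp, unpack. intros H. rewrite !compm1 in H. exact H. Qed.

Definition epic (u v : list C) (q : whom u v) : Prop :=
  forall (w : list C) (a b : whom v w), a ∙ q = b ∙ q -> a = b.

Lemma coequalizer_epic (x u v : list C) (f g : whom x u) (q : whom u v) :
  is_coequalizer f g q -> epic q.
Proof.
intros [Hq Hu] w a b H.
destruct (Hu (obj w) (a ∙ q)) as (k & _ & Hk).
- unfold wcomp. rewrite <- !compA, Hq. reflexivity.
- rewrite <- (Hk a eq_refl). apply Hk. symmetry. exact H.
Qed.

Hypothesis Hpres : coequalizers_preserved C.

(** Joining words is invertible, so that coequalizers preserved by the product
    of objects are preserved by the product of words. *)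
Lemma coequalizer_tens_idw (x u v w : list C) (f g : whom x u) (q : whom u v) :
  is_coequalizer f g q -> is_coequalizer (f ⊠ idw w) (g ⊠ idw w) (q ⊠ idw w).
Proof.
intros H. destruct (proj2 (Hpres H (obj w))) as [E U]. split.
- change ((q ⊠ idw w) ∙ (f ⊠ idw w) = (q ⊠ idw w) ∙ (g ⊠ idw w)).
  rewrite <- !wtens_comp. f_equal. exact (proj1 H).
- intros Z h Eh.
  assert (Ext : forall k : Hom (obj (v ++ w)) Z, k ∘ (q ⊠ idw w) = h <->
    (k ∘ word_join v w) ∘ (q ⊗m idm (obj w)) = h ∘ word_join u w).
  { intros k. unfold wtens, idw. rewrite !compA. split; intros K.
    - rewrite <- K, <- (compA _ (word_split u w)), word_joinK, compm1. reflexivity.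
    - rewrite K, <- compA, word_splitK, compm1. reflexivity. }
  destruct (U _ (h ∘ word_join u w)) as (k & Hk & Hu).
  { apply (f_equal (fun a => a ∘ word_join x w)) in Eh. unfold wtens in Eh.
    rewrite !compA in Eh. rewrite <- !(compA _ (word_split x w)), !word_joinK, !compm1 in Eh.
    exact Eh. }
  exists (k ∘ word_split v w). split.
  + apply Ext. rewrite <- (compA k), word_joinK, compm1. exact Hk.
  + intros k' Hk'. apply Ext, Hu in Hk'. subst k.
    rewrite <- compA, word_splitK, compm1. reflexivity.
Qed.

Lemma coequalizer_idw_tens (x u v w : list C) (f g : whom x u) (q : whom u v) :
  is_coequalizer f g q -> is_coequalizer (idw w ⊠ f) (idw w ⊠ g) (idw w ⊠ q).
Proof.
intros H. destruct (proj1 (Hpres H (obj w))) as [E U]. split.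
- change ((idw w ⊠ q) ∙ (idw w ⊠ f) = (idw w ⊠ q) ∙ (idw w ⊠ g)).
  rewrite <- !wtens_comp. f_equal. exact (proj1 H).
- intros Z h Eh.
  assert (Ext : forall k : Hom (obj (w ++ v)) Z, k ∘ (idw w ⊠ q) = h <->
    (k ∘ word_join w v) ∘ (idm (obj w) ⊗m q) = h ∘ word_join w u).
  { intros k. unfold wtens, idw. rewrite !compA. split; intros K.
    - rewrite <- K, <- (compA _ (word_split w u)), word_joinK, compm1. reflexivity.
    - rewrite K, <- compA, word_splitK, compm1. reflexivity. }
  destruct (U _ (h ∘ word_join w u)) as (k & Hk & Hu).
  { apply (f_equal (fun a => a ∘ word_join w x)) in Eh. unfold wtens in Eh.
    rewrite !compA in Eh. rewrite <- !(compA _ (word_split w x)), !word_joinK, !compm1 in Eh.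
    exact Eh. }
  exists (k ∘ word_split w v). split.
  + apply Ext. rewrite <- (compA k), word_joinK, compm1. exact Hk.
  + intros k' Hk'. apply Ext, Hu in Hk'. subst k.
    rewrite <- compA, word_splitK, compm1. reflexivity.
Qed.

Lemma coequalizer_factor (x u v w : list C) (f g : whom x u) (q : whom u v) (h : whom u w) :
  is_coequalizer f g q -> h ∙ f = h ∙ g -> exists k : whom v w, k ∙ q = h.
Proof. intros [_ Hu] H. destruct (Hu _ h H) as (k & Hk & _). exists k. exact Hk. Qed.

End Words.

Section NonDegenerate.

Variables (C : braided_monoidal_category) (Z V U : C) (v : whom [Z; V] [U]) (Ys : C -> Prop).
Hypothesis Hv : nondegenerate_left v Ys.

Lemma nd_left_words (w : list C) (Y : C) (g g' : whom w [V; Y]) :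
  Ys Y -> (v ⊠ one Y) ∙ (one Z ⊠ g) = (v ⊠ one Y) ∙ (one Z ⊠ g') -> g = g'.
Proof.
intros HY H. apply unpack_inj. apply (Hv HY).
assert (E : forall h : whom w [V; Y], (v ⊠ one Y) ∙ (one Z ⊠ (h ∙ unpack w)) =
  (v ⊠ one Y) ∙ (one Z ⊠ h) ∙ (one Z ⊠ unpack w)).
{ intros h. etransitivity; [|apply wcompA].
  apply (f_equal (fun a => (v ⊠ one Y) ∙ a)), one_tens_comp. }
rewrite !E. exact (f_equal (fun a => a ∙ (one Z ⊠ unpack w)) H).
Qed.

(** The unit object, as a word without letters. *)
Lemma nd_left_words0 (w : list C) (g g' : whom w [V]) :
  Ys unit_ob -> v ∙ (one Z ⊠ g) = v ∙ (one Z ⊠ g') -> g = g'.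
Proof.
intros HY H.
set (i := pack (C := C) [] : whom [] [unit_ob]). set (i' := unpack (C := C) [] : whom [unit_ob] []).
assert (Ki : i' ∙ i = idw []) by apply comp1m.
assert (K : (one V ⊠ i') ∙ (one V ⊠ i) = one V) by diag Ki.
assert (E : (v ⊠ one unit_ob) ∙ (one Z ⊠ one V ⊠ i) = (one U ⊠ i) ∙ v) by diag.
assert (E' : (one V ⊠ i : whom [V] [V; unit_ob]) ∙ g = (one V ⊠ i) ∙ g').
{ apply (nd_left_words HY).
  assert (E' : forall h : whom w [V],
    (v ⊠ one unit_ob) ∙ (one Z ⊠ ((one V ⊠ i : whom [V] [V; unit_ob]) ∙ h))
    = (one U ⊠ i) ∙ (v ∙ (one Z ⊠ h))).
  { intros h. etransitivity; [apply (f_equal (fun a => (v ⊠ one unit_ob) ∙ a)), one_tens_comp|].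
    etransitivity; [apply wcompA|]. etransitivity; [|symmetry; apply wcompA].
    exact (f_equal (fun a => a ∙ (one Z ⊠ h)) E). }
  rewrite !E', H. reflexivity. }
apply (f_equal (fun h => (one V ⊠ i' : whom [V; unit_ob] [V]) ∙ h)) in E'.
rewrite !wcompA in E'.
etransitivity; [symmetry; exact (comp1m g)|].
etransitivity; [|exact (comp1m g')].
etransitivity; [exact (f_equal (fun h => h ∙ g) (eq_sym K))|].
etransitivity; [|exact (f_equal (fun h => h ∙ g') K)]. exact E'.
Qed.

End NonDegenerate.

(** Non-degeneracy on the right without the braiding of its definition: a
    braiding of [V] past the whole domain, together with an inverse crossing of
    [Y] and [Z], moves the argument from one side to the other. *)
Lemma nd_right_words (C : braided_monoidal_category) (Z V U : C) (v : whom [Z; V] [U])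
    (Ys : C -> Prop) (X Y : C) (h h' : whom [X] [Y; Z]) :
  nondegenerate_right v Ys -> Ys Y ->
  (one Y ⊠ v) ∙ (h ⊠ one V) = (one Y ⊠ v) ∙ (h' ⊠ one V) -> h = h'.
Proof.
intros Hv HY H.
assert (E : wbraidV Z Y ∙ h = wbraidV Z Y ∙ h').
{ apply (Hv X Y HY).
  assert (E : forall k : whom [X] [Y; Z],
    ((v ∙ wbraid V Z) ⊠ one Y) ∙ (one V ⊠ (wbraidV Z Y ∙ k)) =
    wbraidV U Y ∙ ((one Y ⊠ v) ∙ (k ⊠ one V)) ∙ wbraid V X).
  { intros k. symmetry.
    diag (eq_sym (braidL_nat V k), braidVL_nat Y v, eq_sym (braidL_nat V (wbraidV Z Y)),
      wbraidK V Y). }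
  rewrite !E, H. reflexivity. }
transitivity (wbraid Z Y ∙ (wbraidV Z Y ∙ h)); [symmetry; diag (wbraidVK Z Y)|].
rewrite E. diag (wbraidVK Z Y).
Qed.

(** * Identities in a weak multiplier bimonoid *)

(** The mirror image of [mult]. *)
Definition rmult (C : braided_monoidal_category) (A : C) (t : whom [A; A] [A; A])
    (j : whom [A] []) : whom [A; A] [A] :=
  (one A ⊠ j) ∙ t.
Arguments rmult {C A} t j.

Section Bimonoid.

Variables (C : braided_monoidal_category) (A : C).
Variables (t1 t2 t3 t4 e1 e2 : whom [A; A] [A; A]) (j : whom [A] []).
Hypothesis HA : regular_weak_multiplier_bimonoid t1 t2 t3 t4 e1 e2 j.
Variable Ys : C -> Prop.
Hypotheses (HYI : Ys unit_ob) (HYA : Ys A).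
Hypothesis Hm : nondegenerate (mult t1 j) Ys.

Local Notation "1" := (one A) : cat_scope.
Local Notation c := (wbraid A A).
Local Notation cV := (wbraidV A A).
Local Notation m := (mult t1 j).
(* With multipliers, s : a ⊗ b ↦ ε(E'a)E''b, r : a ⊗ b ↦ E'a ε(E''b) and
   q : a ⊗ b ↦ a' ε(a''b). *)
Local Notation s := (mult e1 j).
Local Notation r := (rmult e1 j).
Local Notation q := (rmult t1 j).

Let mE : m = (j ⊠ 1) ∙ t1 := eq_refl.
Let sE : s = (j ⊠ 1) ∙ e1 := eq_refl.
Let rE : r = (1 ⊠ j) ∙ e1 := eq_refl.
Let qE : q = (1 ⊠ j) ∙ t1 := eq_refl.
Let H12 := rwmb_12 HA.
Let He12 := rwmb_e12 HA.
Let Hf := rwmb_fusion1 HA.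

Let cK : cV ∙ c = 1 ⊠ 1 := wbraidK A A.
Let cVK : c ∙ cV = 1 ⊠ 1 := wbraidVK A A.

(** With [j] applied to the first factor, the mixed axiom of [t1] and [t3] is
    associativity composed with two inverse crossings. *)
Lemma mult_assoc : m ∙ (m ⊠ 1) = m ∙ (1 ⊠ m).
Proof.
assert (t3E : m ∙ cV = (j ⊠ 1) ∙ t3) by diag (rwmb_m3 HA, cVK).
assert (E : m ∙ (1 ⊠ m) ∙ (cV ⊠ 1) ∙ (1 ⊠ cV) = m ∙ (m ⊠ 1) ∙ (cV ⊠ 1) ∙ (1 ⊠ cV)).
{ pose proof (braidVR_nat A m) as Nm.
  diag (eq_sym Nm, mE, rwmb_13 HA, eq_sym t3E). }
apply (f_equal (fun h => h ∙ ((1 ⊠ c) ∙ (c ⊠ 1)))) in E.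
etransitivity; [|etransitivity; [symmetry; exact E|]]; [symmetry|]; diag (cK, cK).
Qed.

Lemma cancel_mult_l (w : list C) (Y : C) (g g' : whom w [A; Y]) :
  Ys Y -> (m ⊠ one Y) ∙ (1 ⊠ g) = (m ⊠ one Y) ∙ (1 ⊠ g') -> g = g'.
Proof. exact (nd_left_words (proj1 Hm) (g := g) (g' := g')). Qed.

Lemma cancel_mult_l0 (w : list C) (g g' : whom w [A]) :
  m ∙ (1 ⊠ g) = m ∙ (1 ⊠ g') -> g = g'.
Proof. exact (nd_left_words0 (proj1 Hm) HYI (g := g) (g' := g')). Qed.

Lemma cancel_mult_r0 (w : list C) (g g' : whom w [A]) :
  m ∙ (g ⊠ 1) = m ∙ (g' ⊠ 1) -> g = g'.
Proof.
assert (K : forall (X : C) (g g' : whom [X] [A]),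
  m ∙ (g ⊠ 1) = m ∙ (g' ⊠ 1) -> g = g').
{ intros X f f' H. apply (nd_left_words0 (proj2 Hm) HYI).
  transitivity (m ∙ (f ⊠ 1) ∙ wbraid A X); [|rewrite H; symmetry];
    [diag (braidL_nat A f) | diag (braidL_nat A f')]. }
intros H. apply unpack_inj, K.
assert (E : forall h : whom w [A], m ∙ ((h ∙ unpack w) ⊠ 1) = m ∙ (h ⊠ 1) ∙ (unpack w ⊠ 1)).
{ intros h. etransitivity; [|apply wcompA].
  exact (f_equal (fun a => m ∙ a) (tens_one_comp A h (unpack w))). }
rewrite !E. exact (f_equal (fun a => a ∙ (unpack w ⊠ 1)) H).
Qed.

Lemma t1_right_linear : t1 ∙ (1 ⊠ m) = (1 ⊠ m) ∙ (t1 ⊠ 1).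
Proof.
apply (cancel_mult_l HYA).
diag (H12, eq_sym mult_assoc, eq_sym H12).
Qed.

(** The counit axioms, here and in [mult_s], solved for the side without [t1]. *)
Lemma mult_r : m ∙ (1 ⊠ r) = m ∙ (q ⊠ 1) ∙ (1 ⊠ cV).
Proof. diag (rE, eq_sym cVK, eq_sym (wcf_counit1 Hf), eq_sym qE). Qed.

Lemma mult_s : m ∙ (1 ⊠ s) = (j ⊠ 1) ∙ (m ⊠ 1) ∙ (1 ⊠ c) ∙ (t1 ⊠ 1) ∙ (1 ⊠ cV).
Proof. diag (sE, eq_sym cVK, eq_sym (wcf_counit2 Hf)). Qed.

(** Once the remaining output is discarded, the sides with [t1] of the two counit
    axioms coincide, since the braiding is natural with respect to [j]. *)
Lemma counit_mult_s_r : j ∙ m ∙ (1 ⊠ s) = j ∙ m ∙ (1 ⊠ r).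
Proof. diag (mult_s, eq_sym (braidR_nat A j), eq_sym qE, eq_sym mult_r). Qed.

Lemma mult_q : m ∙ (q ⊠ 1) = m ∙ (1 ⊠ r) ∙ (1 ⊠ c).
Proof. symmetry. diag (mult_r, cK). Qed.

(** By [wcf_counit1], [q] is the multiplication on the right by a multiplier. *)
Lemma q_left_linear : q ∙ (m ⊠ 1) = m ∙ (1 ⊠ q).
Proof.
apply cancel_mult_r0.
diag (mult_q, mult_assoc, eq_sym mult_q, eq_sym mult_assoc).
Qed.

Lemma counit_q : j ∙ q = j ∙ m.
Proof. diag (qE, eq_sym mE). Qed.

Lemma counit_mult_q : j ∙ m ∙ (1 ⊠ q) = j ∙ m ∙ (1 ⊠ m).
Proof. diag (eq_sym q_left_linear, counit_q, mult_assoc). Qed.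

(** As a left multiple of [q] is [j ∙ m] applied to [t2], this is
    [counit_mult_s_r] for the second output of [t2]. *)
Lemma q_s_r : q ∙ (1 ⊠ s) = q ∙ (1 ⊠ r).
Proof.
apply cancel_mult_l0.
diag (qE, H12, counit_mult_s_r, eq_sym H12, eq_sym qE).
Qed.

(** This is [mult_s] for the second output of [t1]. A left multiple of [t1] is
    [t2] followed by [m], to which [mult_s] applies, and [t1] and [t2] commute. *)
Lemma t1_s : t1 ∙ (1 ⊠ s) = (q ⊠ 1) ∙ (1 ⊠ c) ∙ (t1 ⊠ 1) ∙ (1 ⊠ cV).
Proof.
apply (cancel_mult_l HYA).
diag (H12, mult_s, eq_sym (rwmb_comm21 HA), eq_sym H12, eq_sym qE).
Qed.

(** Multiplied by d on the left, both sides become ε(d'p(a)b) d''c: the left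
    hand side by [mult_s], the right hand side by [mult_s] and [t1_s] followed
    by [counit_mult_s_r]. The crossings of the two results agree by the braid
    relation. *)
Lemma s_assoc : s ∙ (s ⊠ 1) = s ∙ (1 ⊠ s).
Proof.
apply cancel_mult_l0.
transitivity (((j ∙ m ∙ (1 ⊠ s)) ⊠ 1) ∙ (1 ⊠ 1 ⊠ c) ∙ (1 ⊠ c ⊠ 1) ∙ (t1 ⊠ 1 ⊠ 1) ∙
   (1 ⊠ cV ⊠ 1) ∙ (1 ⊠ 1 ⊠ cV)).
- diag (mult_s, braidVR_nat A s, braidL_nat A s).
- symmetry. diag (mult_s, braidVL_nat A s, t1_s, mult_q, eq_sym counit_mult_s_r,
    eq_sym (braidL_nat A c), eq_sym (braidVL_nat A cV), cVK).
Qed.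

(** This and the three lemmas below are [wcf_comm], [wcf_te] (twice) and
    [wcf_fusion] with [j] applied to one factor. *)
Lemma t1_s_left : t1 ∙ (s ⊠ 1) = (s ⊠ 1) ∙ (1 ⊠ t1).
Proof. symmetry. diag (sE, wcf_comm Hf, eq_sym sE). Qed.

Lemma e1_left : e1 ∙ (m ⊠ 1) = (m ⊠ 1) ∙ (1 ⊠ c) ∙ (e1 ⊠ 1) ∙ (1 ⊠ cV).
Proof. diag (mE, eq_sym (wcf_te Hf), eq_sym mE). Qed.

Lemma s_t1 : (1 ⊠ s) ∙ (t1 ⊠ 1) = (q ⊠ 1) ∙ (1 ⊠ c) ∙ (e1 ⊠ 1) ∙ (1 ⊠ cV).
Proof. diag (sE, eq_sym (wcf_te Hf), eq_sym qE). Qed.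

Lemma t1_mult : t1 ∙ (m ⊠ 1) = (m ⊠ 1) ∙ (cV ⊠ 1) ∙ (1 ⊠ t1) ∙ (c ⊠ 1) ∙ (1 ⊠ t1).
Proof. diag (mE, eq_sym (wcf_fusion Hf), eq_sym mE). Qed.

(** Left multiplication on both factors, the form in which [e1] can be traded
    for [e2]. The second factor is brought to the front by a braiding. *)
Lemma cancel_mult_mult (w : list C) (g g' : whom w [A; A]) :
  (m ⊠ m) ∙ (1 ⊠ c ⊠ 1) ∙ (1 ⊠ 1 ⊠ g) = (m ⊠ m) ∙ (1 ⊠ c ⊠ 1) ∙ (1 ⊠ 1 ⊠ g') -> g = g'.
Proof.
assert (K : forall (X : C) (g g' : whom [X] [A; A]),
  (m ⊠ m) ∙ (1 ⊠ c ⊠ 1) ∙ (1 ⊠ 1 ⊠ g) = (m ⊠ m) ∙ (1 ⊠ c ⊠ 1) ∙ (1 ⊠ 1 ⊠ g') -> g = g').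
{ intros X f f' H.
  apply (cancel_mult_l HYA).
  assert (E : cV ∙ ((m ⊠ 1) ∙ (1 ⊠ f)) = cV ∙ ((m ⊠ 1) ∙ (1 ⊠ f'))).
  { apply (cancel_mult_l HYA).
    assert (E : forall h : whom [X] [A; A],
      (m ⊠ 1) ∙ (1 ⊠ (cV ∙ ((m ⊠ 1) ∙ (1 ⊠ h)))) =
      cV ∙ ((m ⊠ m) ∙ (1 ⊠ c ⊠ 1) ∙ (1 ⊠ 1 ⊠ h)) ∙ (c ⊠ one X)).
    { intros h.
      diag (eq_sym cK, braidR_nat A m, cVK, braidL_nat A m). }
    rewrite !E, H. reflexivity. }
  apply (f_equal (fun h => c ∙ h)) in E.
  transitivity (c ∙ (cV ∙ ((m ⊠ 1) ∙ (1 ⊠ f)))); [symmetry; diag cVK|].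
  rewrite E. diag cVK. }
intros H. apply unpack_inj, K.
assert (E : forall h : whom w [A; A], (m ⊠ m) ∙ (1 ⊠ c ⊠ 1) ∙ (1 ⊠ 1 ⊠ (h ∙ unpack w)) =
   (m ⊠ m) ∙ (1 ⊠ c ⊠ 1) ∙ (1 ⊠ 1 ⊠ h) ∙ (1 ⊠ 1 ⊠ unpack w)).
{ intros h. etransitivity; [|apply wcompA].
  apply (f_equal (fun a => _ ∙ a)). etransitivity; [|exact (one_tens_comp A _ _)].
  exact (f_equal (fun a => 1 ⊠ a) (one_tens_comp A h (unpack w))). }
rewrite !E. exact (f_equal (fun a => a ∙ (1 ⊠ 1 ⊠ unpack w)) H).
Qed.

Lemma e1_right_linear : e1 ∙ (1 ⊠ m) = (1 ⊠ m) ∙ (e1 ⊠ 1).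
Proof.
apply cancel_mult_mult.
diag (He12, eq_sym mult_assoc, eq_sym He12, mult_assoc).
Qed.

Lemma s_right_linear : s ∙ (1 ⊠ m) = m ∙ (s ⊠ 1).
Proof. diag (sE, e1_right_linear, eq_sym sE). Qed.

(** * The base object *)

Variables (L : C) (p : whom [A] [L]) (n1 : whom [L; A] [A]).
Hypothesis Hp : @is_coequalizer C (obj [A; A]) (obj [A]) (obj [L]) s r p.
Hypothesis Hn1 : n1 ∙ (p ⊠ 1) = s.
Hypothesis Hn1nd : nondegenerate_right n1 Ys.

Let Hps : p ∙ s = p ∙ r := proj1 Hp.

(** By [mult_s], w p(g) d = ε(w'g) w''d; here w can be cancelled since [m] is
    non-degenerate and d since [n1] is. *)
Lemma base_map_determined (w : list C) (Y : C) (g g' : whom w [A; Y]) :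
  Ys Y ->
  ((j ∙ m) ⊠ one Y) ∙ (1 ⊠ g) = ((j ∙ m) ⊠ one Y) ∙ (1 ⊠ g') ->
  (p ⊠ one Y) ∙ g = (p ⊠ one Y) ∙ g'.
Proof.
intros HY.
assert (K : forall (X : C) (g g' : whom [X] [A; Y]),
  ((j ∙ m) ⊠ one Y) ∙ (1 ⊠ g) = ((j ∙ m) ⊠ one Y) ∙ (1 ⊠ g') ->
  (p ⊠ one Y) ∙ g = (p ⊠ one Y) ∙ g').
{ intros X f f' H.
  apply (nd_left_words Hn1nd HY).
  apply (cancel_mult_l HY).
  assert (E : forall h : whom [X] [A; Y],
    (m ⊠ one Y) ∙ (1 ⊠ (((n1 ∙ wbraid A L) ⊠ one Y) ∙ (1 ⊠ ((p ⊠ one Y) ∙ h)))) =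
    wbraidV A Y ∙ (((((j ∙ m) ⊠ one Y) ∙ (1 ⊠ h)) ⊠ 1) ∙ (1 ⊠ wbraid A X) ∙ (t1 ⊠ one X))).
  { intros h.
    diag (braidL_nat A p, Hn1, mult_s, cK, eq_sym (wbraidK A Y), braidL_nat A h). }
  rewrite !E, H. reflexivity. }
intros H. apply unpack_inj.
etransitivity; [|etransitivity]; [| apply (K (obj w) (g ∙ unpack w) (g' ∙ unpack w)) |].
- symmetry. apply wcompA.
- assert (E : forall h : whom w [A; Y], ((j ∙ m) ⊠ one Y) ∙ (1 ⊠ (h ∙ unpack w)) =
    ((j ∙ m) ⊠ one Y) ∙ (1 ⊠ h) ∙ (1 ⊠ unpack w)).
  { intros h. etransitivity; [|apply wcompA].
    apply (f_equal (fun a => _ ∙ a)). exact (one_tens_comp A h (unpack w)). }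
  rewrite !E. exact (f_equal (fun a => a ∙ (1 ⊠ unpack w)) H).
- apply wcompA.
Qed.

Lemma base_map_determined0 (w : list C) (g g' : whom w [A]) :
  j ∙ m ∙ (1 ⊠ g) = j ∙ m ∙ (1 ⊠ g') -> p ∙ g = p ∙ g'.
Proof.
intros H.
set (i := pack (C := C) [] : whom [] [unit_ob]). set (i' := unpack (C := C) [] : whom [unit_ob] []).
assert (Ki : i' ∙ i = idw []) by apply comp1m.
assert (E : forall h : whom w [A],
  ((j ∙ m) ⊠ one unit_ob) ∙ (1 ⊠ ((1 ⊠ i : whom [A] [A; unit_ob]) ∙ h)) =
  i ∙ (j ∙ m ∙ (1 ⊠ h))).
{ intros h.
  assert (E0 : ((j ∙ m) ⊠ one unit_ob) ∙ (1 ⊠ 1 ⊠ i) = i ∙ (j ∙ m)) by diag.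
  etransitivity; [apply (f_equal (fun a => _ ∙ a)); exact (one_tens_comp A (1 ⊠ i : whom [A] [A; unit_ob]) h)|].
  etransitivity; [apply wcompA|]. etransitivity; [|symmetry; apply wcompA].
  exact (f_equal (fun a => a ∙ (1 ⊠ h)) E0). }
assert (K : (p ⊠ one unit_ob) ∙ ((1 ⊠ i : whom [A] [A; unit_ob]) ∙ g) =
  (p ⊠ one unit_ob) ∙ ((1 ⊠ i : whom [A] [A; unit_ob]) ∙ g')).
{ apply (base_map_determined HYI). rewrite !E, H. reflexivity. }
assert (E1 : (one L ⊠ i') ∙ ((p ⊠ one unit_ob) ∙ (1 ⊠ i)) = p) by diag Ki.
apply (f_equal (fun a => (one L ⊠ i' : whom [L; unit_ob] [L]) ∙ a)) in K.
rewrite !wcompA in K.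
etransitivity; [exact (f_equal (fun a => a ∙ g) (eq_sym E1))|].
etransitivity; [|exact (f_equal (fun a => a ∙ g') E1)].
rewrite !wcompA. exact K.
Qed.

Lemma p_q : p ∙ q = p ∙ m.
Proof. apply base_map_determined0, counit_mult_q. Qed.

(** With x = p(b)c, [counit_mult_s_r] and [mult_r] turn ε(w p(a)x) into
    ε(w'a)ε(w''x), and [q_s_r] applies to x. *)
Lemma p_s_s : p ∙ s ∙ (1 ⊠ s) = p ∙ s ∙ (1 ⊠ r).
Proof.
transitivity (p ∙ (s ∙ (1 ⊠ s))); [diag|].
transitivity (p ∙ (s ∙ (1 ⊠ r))); [|diag].
apply base_map_determined0.
diag (counit_mult_s_r, mult_r, braidVL_nat A s, q_s_r,
  eq_sym (braidVL_nat A r), eq_sym mult_r, eq_sym counit_mult_s_r).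
Qed.

(** By [s_t1], which contains [q]; below [p] it becomes [m], by [p_q]. *)
Lemma p_s_t1 : (p ⊠ s) ∙ (t1 ⊠ 1) = (p ⊠ 1) ∙ e1 ∙ (m ⊠ 1).
Proof. diag (s_t1, p_q, eq_sym e1_left). Qed.

(** Under [base_map_determined] this concerns ε(w E'x) E''c. After a further left
    multiplication of the second factor, [e1] becomes [e2] acting on the
    multiplying factors, and x = s(a ⊗ b) stands directly under [j ∙ m]. *)
Lemma p_e1_s : (p ⊠ 1) ∙ e1 ∙ (s ⊠ 1) = (p ⊠ 1) ∙ e1 ∙ (r ⊠ 1).
Proof.
transitivity ((p ⊠ 1) ∙ (e1 ∙ (s ⊠ 1))); [diag|].
transitivity ((p ⊠ 1) ∙ (e1 ∙ (r ⊠ 1))); [|diag].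
apply (base_map_determined HYA), cancel_mult_l0.
diag (braidL_nat A j, braidL_nat A m, He12, braidL_nat A s, counit_mult_s_r,
  eq_sym (braidL_nat A r), eq_sym He12, eq_sym (braidL_nat A m), eq_sym (braidL_nat A j)).
Qed.

Hypothesis Hpres : coequalizers_preserved C.

Lemma p_epic (l w : list C) : epic (idw l ⊠ p ⊠ idw w).
Proof.
exact (coequalizer_epic (coequalizer_idw_tens Hpres l (coequalizer_tens_idw Hpres w Hp))).
Qed.

Variables (D : C) (d d' : whom [D] [A; A]).
Hypothesis Hd : @is_coequalizer C (obj [D]) (obj [A; A]) (obj [A]) d d' m.

Lemma m_epic (l w : list C) : epic (idw l ⊠ m ⊠ idw w).
Proof.
exact (coequalizer_epic (coequalizer_idw_tens Hpres l (coequalizer_tens_idw Hpres w Hd))).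
Qed.

Lemma base_mult_exists : exists mu : whom [L; L] [L], mu ∙ (one L ⊠ p) = p ∙ n1.
Proof.
apply (coequalizer_factor (coequalizer_idw_tens Hpres [L] Hp)).
apply (@p_epic [] [A; A]).
change ((p ∙ n1) ∙ (one L ⊠ s) ∙ (idw [] ⊠ p ⊠ idw [A; A]) =
        (p ∙ n1) ∙ (one L ⊠ r) ∙ (idw [] ⊠ p ⊠ idw [A; A])).
diag (Hn1, p_s_s, eq_sym Hn1).
Qed.

(** The action of δ(l) on the second factor, known before δ. *)
Lemma comult_action_exists :
  exists k : whom [L; A] [L; A], k ∙ (p ⊠ 1) = (p ⊠ 1) ∙ e1.
Proof.
apply (coequalizer_factor (coequalizer_tens_idw Hpres [A] Hp)). exact p_e1_s.
Qed.

(** Acting on a third factor, both composites in question pass through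
    [k ∙ ((p ∙ m) ⊠ 1)] by [p_s_t1]. *)
Lemma base_comult_exists (E : C) (f f' : whom [E] [A; A]) :
  @is_coequalizer C (obj [E]) (obj [A; A]) (obj [L]) f f' (p ∙ m) -> Ys L ->
  exists delta : whom [L] [L; L], delta ∙ (p ∙ m) = (p ⊠ p) ∙ t1.
Proof.
intros Hpm HYL. apply (coequalizer_factor Hpm).
apply (nd_right_words Hn1nd HYL).
destruct comult_action_exists as [k Hk].
assert (Ef : p ∙ m ∙ f = p ∙ m ∙ f') by exact (proj1 Hpm).
diag (Hn1, p_s_t1, eq_sym Hk, Ef, Hk, eq_sym p_s_t1, eq_sym Hn1).
Qed.

Lemma base_counit_exists : exists eps : whom [L] [], eps ∙ p = j.
Proof.
apply (coequalizer_factor Hp). diag (sE, eq_sym rE).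
Qed.

Variables (mu : whom [L; L] [L]) (delta : whom [L] [L; L]) (eps : whom [L] []).
Hypothesis Hmu : mu ∙ (one L ⊠ p) = p ∙ n1.
Hypothesis Hdelta : delta ∙ (p ∙ m) = (p ⊠ p) ∙ t1.
Hypothesis Heps : eps ∙ p = j.

Local Notation "'1L'" := (one L) : cat_scope.

Lemma mu_p_p : mu ∙ (p ⊠ p) = p ∙ s.
Proof. diag (Hmu, Hn1). Qed.

Lemma mu_assoc : associative mu.
Proof.
apply (@p_epic [] [L; L]), (@p_epic [A] [L]), (@p_epic [A; A] []).
diag (mu_p_p, mu_p_p, s_assoc, eq_sym mu_p_p, eq_sym mu_p_p).
Qed.

Lemma base_action : n1 ∙ (mu ⊠ 1) = n1 ∙ (1L ⊠ n1).
Proof.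
apply (@p_epic [] [L; A]), (@p_epic [A] [A]).
diag (mu_p_p, Hn1, s_assoc, eq_sym Hn1, eq_sym Hn1).
Qed.

Lemma delta_coassoc : coassociative delta.
Proof.
apply (@p_epic [] []), (@m_epic [] []), (@m_epic [] [A]).
diag (Hdelta, t1_mult, Hdelta, wcf_fusion Hf, eq_sym Hdelta, eq_sym t1_right_linear,
  eq_sym Hdelta, eq_sym mult_assoc).
Qed.

Lemma delta_counital : counital delta eps.
Proof.
split; apply (@p_epic [] []), (@m_epic [] []).
- diag (Hdelta, Heps, eq_sym mE).
- diag (Hdelta, Heps, eq_sym qE, p_q).
Qed.

Lemma mu_delta : mu ∙ delta = 1L.
Proof.
apply (@p_epic [] []), (@m_epic [] []).
diag (Hdelta, mu_p_p, sE, wcf_et Hf, eq_sym mE).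
Qed.

Lemma delta_left_linear : (mu ⊠ 1L) ∙ (1L ⊠ delta) = delta ∙ mu.
Proof.
apply (@p_epic [] [L]), (@p_epic [A] []), (@m_epic [A] []).
symmetry.
diag (mu_p_p, s_right_linear, Hdelta, t1_s_left, eq_sym mu_p_p, eq_sym Hdelta).
Qed.

(** Moving p(a) through [t1] by [t1_s_left] leaves p(p(a)b'), which is
    p(E'a ε(E''b')); then [wcf_comm] takes E'' out of the comultiplication. *)
Lemma delta_mu_p_p : delta ∙ mu ∙ (p ⊠ p) = (p ⊠ p) ∙ e1.
Proof.
apply (@m_epic [A] []).
diag (mu_p_p, s_right_linear, Hdelta, t1_s_left, Hps, rE, wcf_comm Hf, eq_sym mE,
  eq_sym e1_right_linear).
Qed.

(** By [p_s_t1], composing the right hand side with p ⊗ p also gives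
    (p ⊗ p)E. *)
Lemma delta_right_linear : delta ∙ mu = (1L ⊠ mu) ∙ (delta ⊠ 1L).
Proof.
apply (@p_epic [] [L]), (@p_epic [A] []), (@m_epic [] [A]).
diag (delta_mu_p_p, eq_sym p_s_t1, eq_sym mu_p_p, eq_sym Hdelta).
Qed.

End Bimonoid.

Theorem theorem3p4 (C : braided_monoidal_category)
  (Hcoeq : has_coequalizers C)
  (Hpres : coequalizers_preserved C)
  (Hepi : regular_epis_compose C)
  (A : C) (t1 t2 t3 t4 e1 e2 : whom [A; A] [A; A]) (j : whom [A] [])
  (HA : regular_weak_multiplier_bimonoid t1 t2 t3 t4 e1 e2 j)
  (L : C) (p : whom [A] [L])
  (Hp : is_coequalizer ((j ⊠ one A) ∙ e1) ((one A ⊠ j) ∙ e1) p)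
  (n1 : whom [L; A] [A])
  (Hn1 : n1 ∙ (p ⊠ one A) = (j ⊠ one A) ∙ e1)
  (Hm : regular_epi (mult t1 j))
  (Ys : C -> Prop)
  (HYI : Ys unit_ob) (HYA : Ys A) (HYAA : Ys (A ⊗ A)) (HYL : Ys L)
  (Hmnd : nondegenerate (mult t1 j) Ys)
  (Hn1nd : nondegenerate_right n1 Ys) :
  exists (mu : whom [L; L] [L]) (delta : whom [L] [L; L]) (eps : whom [L] []),
    (associative mu /\ n1 ∙ (mu ⊠ one A) = n1 ∙ (one L ⊠ n1)) /\
    (coassociative delta /\ delta ∙ p ∙ mult t1 j = (p ⊠ p) ∙ t1) /\
    mu ∙ delta = one L /\
    ((mu ⊠ one L) ∙ (one L ⊠ delta) = delta ∙ mu /\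
     delta ∙ mu = (one L ⊠ mu) ∙ (delta ⊠ one L)) /\
    (counital delta eps /\ eps ∙ p = j) /\
    coseparable_comonoid delta eps.
Proof.
assert (Hp' : @is_coequalizer C (obj [A; A]) (obj [A]) (obj [L]) (mult e1 j) (rmult e1 j) p)
  by exact Hp.
assert (Hn1' : n1 ∙ (p ⊠ one A) = mult e1 j) by exact Hn1.
assert (Hpr : @regular_epi C (obj [A]) (obj [L]) p) by (exists (obj [A; A]); eauto).
destruct (Hepi _ _ _ _ _ Hm Hpr) as (E & f & f' & Hpm).
destruct Hm as (D & d & d' & Hd).
destruct (base_mult_exists HA HYI Hmnd Hp' Hn1' Hn1nd Hpres) as [mu Hmu].
destruct (base_comult_exists HA HYI HYA Hmnd Hp' Hn1' Hn1nd Hpres (E := E) Hpm HYL) as [delta Hdelta].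
destruct (base_counit_exists Hp') as [eps Heps].
pose proof (delta_coassoc HA HYA Hmnd Hp' Hpres (D := D) Hd Hdelta) as Hcoassoc.
pose proof (delta_counital HA HYI Hmnd Hp' Hn1' Hn1nd Hpres (D := D) Hd Hdelta Heps) as Hcounit.
pose proof (mu_delta HA Hp' Hn1' Hpres (D := D) Hd Hmu Hdelta) as Hmudelta.
assert (Hfrob : frobenius mu delta).
{ split.
  - exact (delta_left_linear HA HYA Hmnd Hp' Hn1' Hpres (D := D) Hd Hmu Hdelta).
  - exact (delta_right_linear HA HYI HYA Hmnd Hp' Hn1' Hn1nd Hpres (D := D) Hd Hmu Hdelta). }
exists mu, delta, eps. split; [|split; [|split; [|split; [|split]]]].
- split.
  + exact (mu_assoc HA HYI HYA Hmnd Hp' Hn1' Hpres Hmu).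
  + exact (base_action HA HYI HYA Hmnd Hp' Hn1' Hpres Hmu).
- split; [exact Hcoassoc|]. etransitivity; [symmetry; apply wcompA | exact Hdelta].
- exact Hmudelta.
- exact Hfrob.
- split; [exact Hcounit | exact Heps].
- split; [split; [exact Hcoassoc | exact Hcounit]|].
  exists mu. split; [exact Hmudelta | exact Hfrob].
Qed.
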